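(* Let $\lambda>\lambda_0$, let $u_1,u_2$ be viscosity solutions of $a(x)u''+H(x,u')=\lambda$ in $\mathbb R$, and let $v_1,v_2$ be viscosity solutions of $a(x)u''+H(x,u')=\lambda_0$ in $\mathbb R$. (a) If $u_i'\ge v_i'$ a.e. on $\mathbb R$ for $i=1,2$, then $u_1-u_2$ is constant on $\mathbb R$. (b) If $u_i'\le v_i'$ a.e. on $\mathbb R$ for $i=1,2$, then $u_1-u_2$ is constant on $\mathbb R$.
   Context: Deterministic setting: $a:\mathbb R\to[0,1]$ with $\sqrt a$ $\kappa$-Lipschitz and (A1$'$): $a\not\equiv0$ and every connected component of $A:=\{a>0\}$ is a bounded interval. $H:\mathbb R\times\mathbb R\to\mathbb R$ in $\mathscr H_{sqc}(\alpha_0,\alpha_1,\gamma,\eta)$, $\gamma>2$, $\eta>0$: (H1) $\alpha_0|p|^\gamma-1/\alpha_0\le H(x,p)\le\alpha_1(|p|^\gamma+1)$, (H2) $|H(x,p)-H(x,q)|\le\alpha_1(|p|+|q|+1)^{\gamma-1}|p-q|$, (H3) $|H(x,p)-H(y,p)|\le\alpha_1(|p|^\gamma+1)|x-y|$, $H(x,\cdot)$ strictly quasiconvex with unique minimizer $\hat p(x)$, $H(x,p_1)-H(x,p_2)\ge\eta|p_1-p_2|$ for $p_1<p_2\le\hat p(x)$, $H(x,p_2)-H(x,p_1)\ge\eta|p_1-p_2|$ for $p_2>p_1\ge\hat p(x)$. Viscosity conventions: supersolution if $a\varphi''+H(x,\varphi')\le\lambda$ for $C^2$ $\varphi$ touching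 from below, subsolution if $\ge\lambda$ touching from above; solutions are continuous. $\lambda_0:=\inf\{\lambda:\ a u''+H(x,u')=\lambda$ admits a continuous viscosity supersolution on $\mathbb R\}$. (Viscosity solutions of these equations are Lipschitz, hence differentiable a.e.) *)

(* Defs.v *)
From HB Require Import structures.
From mathcomp Require Import all_boot all_order all_algebra.
From mathcomp Require Import all_classical all_reals all_analysis.
Set Implicit Arguments. Unset Strict Implicit. Unset Printing Implicit Defensive.
Import Order.TTheory GRing.Theory Num.Theory.
Import numFieldNormedType.Exports.
Local Open Scope classical_set_scope.
Local Open Scope ring_scope.

Section Defs.
Variable R : realType.

Definition diffusion_ok (kappa : R) (a : R -> R) : Prop :=
  [/\ (forall x, 0 <= a x <= 1),
      (forall x y, `|Num.sqrt (a x) - Num.sqrt (a y)| <= kappa * `|x - y|),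
      (exists x, a x != 0) &
      (forall x, 0 < a x ->
         is_interval (connected_component [set y | 0 < a y] x) /\
         exists M : R, forall y, connected_component [set y | 0 < a y] x y ->
           `|y| <= M)].

Definition strictly_quasiconvex (h : R -> R) : Prop :=
  forall p q t, p != q -> 0 < t < 1 ->
    h (t * p + (1 - t) * q) < Num.max (h p) (h q).

Definition H_sqc (alpha0 alpha1 gamma eta : R) (H : R -> R -> R) : Prop :=
  [/\ (forall x p, alpha0 * (`|p| `^ gamma) - alpha0^-1 <= H x p
                   /\ H x p <= alpha1 * (`|p| `^ gamma + 1)),
      (forall x p q, `|H x p - H x q|
                     <= alpha1 * ((`|p| + `|q| + 1) `^ (gamma - 1)) * `|p - q|),
      (forall x y p, `|H x p - H y p| <= alpha1 * (`|p| `^ gamma + 1) * `|x - y|),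
      (forall x, strictly_quasiconvex (H x)) &
      exists phat : R -> R, forall x,
        [/\ (forall p, H x (phat x) <= H x p),
            (forall p, p != phat x -> H x (phat x) < H x p),
            (forall p1 p2, p1 < p2 -> p2 <= phat x ->
               H x p1 - H x p2 >= eta * `|p1 - p2|) &
            (forall p1 p2, p1 < p2 -> phat x <= p1 ->
               H x p2 - H x p1 >= eta * `|p1 - p2|)]].

Definition C2 (phi : R -> R) : Prop :=
  [/\ (forall x, derivable phi x 1),
      (forall x, derivable (derive1 phi) x 1) &
      continuous (derive1n 2 phi)].

Definition touches_below (phi u : R -> R) (x0 : R) : Prop :=
  phi x0 = u x0 /\ exists2 d : R, 0 < d & forall y, `|y - x0| < d -> phi y <= u y.
Definition touches_above (phi u : R -> R) (x0 : R) : Prop :=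
  phi x0 = u x0 /\ exists2 d : R, 0 < d & forall y, `|y - x0| < d -> u y <= phi y.

Definition visc_super (a : R -> R) (H : R -> R -> R) (lam : R) (u : R -> R) :=
  continuous u /\
  forall phi x0, C2 phi -> touches_below phi u x0 ->
    a x0 * derive1n 2 phi x0 + H x0 (derive1 phi x0) <= lam.
Definition visc_sub (a : R -> R) (H : R -> R -> R) (lam : R) (u : R -> R) :=
  continuous u /\
  forall phi x0, C2 phi -> touches_above phi u x0 ->
    a x0 * derive1n 2 phi x0 + H x0 (derive1 phi x0) >= lam.
Definition visc_sol a H lam u := visc_super a H lam u /\ visc_sub a H lam u.

Definition lambda0 (a : R -> R) (H : R -> R -> R) : \bar R :=
  ereal_inf [set (lam%:E) | lam in [set lam : R | exists u, visc_super a H lam u]].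

Definition ae_deriv_ge (u v : R -> R) : Prop :=
  {ae (@lebesgue_measure R), forall x,
      [/\ derivable u x 1, derivable v x 1 & derive1 v x <= derive1 u x]}.

End Defs.

(* Main.v *)
(** Test functions enter only through quadratic jets. On [{a > 0}] the supersolution
property makes [u] semiconcave and the subsolution property excludes concave corners,
so [u] is twice differentiable there and [f = u'] solves [a f' = lam - H(x, f)].

Let [a z = 0]. Since [sqrt a] is Lipschitz, [a <= K (x - l)^2] near any zero [l] of [a],
and this singular ODE makes unstable solutions blow up as [x] decreases to the left end
[l] of a component of [{a > 0}]. Together with [u' >= v'], where [v] solves the equation
at the lower level [mu < lam], this forces [u'] to be close to the larger root [p+(z)] of
[H(z, .) = lam] on [{a > 0}] just to the right of [z]; a viscosity mean value theorem
then gives the right derivative [u'(z+) = p+(z)], for both solutions. Inside a component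
the difference [g] of the two derivatives satisfies [a g' <= - eta g] near [l], so it
would blow up there unless [g = 0], and uniqueness for the ODE propagates [g = 0] to the
whole component. Hence [u1 - u2] has vanishing right derivative everywhere. Part (b)
follows from (a) by the reflection [x -> - x]. *)

Require Import Defs.
From HB Require Import structures.
From mathcomp Require Import all_boot all_order all_algebra.
From mathcomp Require Import all_classical all_reals all_analysis.
From mathcomp Require Import ring lra.
Set Implicit Arguments. Unset Strict Implicit. Unset Printing Implicit Defensive.
Import Order.TTheory GRing.Theory Num.Theory.
Import numFieldNormedType.Exports.
Local Open Scope classical_set_scope.
Local Open Scope ring_scope.

(** * Real functions *)

Section RealAnalysis.
Variable R : realType.
Implicit Types (u v f k : R -> R) (x y z l m p C D K : R).

Lemma continuous_atP f x : {for x, continuous f} <->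
  forall e : R, 0 < e -> exists2 d : R, 0 < d & forall y, `|y - x| < d -> `|f y - f x| < e.
Proof.
split=> [/cvgrPdist_lt h e e0|h].
  have /nbhs_ballP[d d0 hd] := h e e0.
  exists d => // y yx; rewrite distrC; apply: hd.
  by rewrite /ball /= distrC.
apply/cvgrPdist_lt => e e0; have [d d0 hd] := h e e0.
apply/nbhs_ballP; exists d => // y; rewrite /ball /= => yx.
by rewrite distrC; apply: hd; rewrite distrC.
Qed.

(** The point [y = x] is harmless because both sides vanish there. Later arguments use derivatives
    mostly through this first-order error estimate. *)
Lemma is_derive_smallP f x D : is_derive x 1 f D <->
  forall e : R, 0 < e -> exists2 d : R, 0 < d &
    forall y, `|y - x| < d -> `|f y - f x - D * (y - x)| <= e * `|y - x|.
Proof.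
have E (h : R) : h^-1 *: (f (h *: 1 + x) - f x) = (f (x + h) - f x) / h.
  by rewrite scaler1 [RHS]mulrC [X in f X]addrC.
split=> [[df <-]|H].
  have {df}/cvgrPdist_le df := df.
  move=> e e0; have /nbhs_ballP[d /= d0 hd] := df e e0.
  exists d => // y yx; have [->|ynx] := eqVneq y x.
    by rewrite !subrr mulr0 subrr normr0 mulr0.
  have yx0 : y - x != 0 by rewrite subr_eq0.
  have := hd (y - x); rewrite /ball /= sub0r normrN => /(_ yx yx0).
  rewrite -/('D_1 f x) E [x + _]addrC subrK.
  rewrite -(ler_pM2r (x := `|y - x|)) ?normr_gt0// -normrM mulrBl divfK//.
  by rewrite distrC.
have cv : (fun h => h^-1 *: (f (h *: 1 + x) - f x)) @ 0^' --> D.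
  apply/cvgrPdist_le => e e0; have [d d0 hd] := H e e0.
  apply/nbhs_ballP; exists d => // h; rewrite /ball /= sub0r normrN => hh h0.
  have := hd (x + h); rewrite addrAC subrr add0r => /(_ hh) le_e.
  rewrite E -(ler_pM2r (x := `|h|)) ?normr_gt0// -normrM mulrBl divfK//.
  by rewrite distrC.
split; last exact/cvg_lim.
by apply/cvg_ex; exists D.
Qed.

Lemma is_derive_continuous f x D : is_derive x 1 f D -> {for x, continuous f}.
Proof.
by move=> [df _]; apply/differentiable_continuous/derivable1_diffP.
Qed.

Lemma is_derive_unique f x D D' :
  is_derive x 1 f D -> is_derive x 1 f D' -> D = D'.
Proof. by move=> [_ <-] [_ <-]. Qed.

Lemma pointwise_within f x y :
  (forall t, x <= t <= y -> {for t, continuous f}) ->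
  {within `[x, y], continuous f}.
Proof.
move=> h; apply: continuous_in_subspaceT => t.
by rewrite inE /= in_itv /= => /h.
Qed.

Lemma EVT_min_pointwise f x y : x <= y ->
  (forall t, x <= t <= y -> {for t, continuous f}) ->
  exists2 z, x <= z <= y & forall t, x <= t <= y -> f z <= f t.
Proof.
move=> xy /pointwise_within cf; have [z] := EVT_min xy cf.
by rewrite in_itv /= => zi zm; exists z => // t ti; apply: zm; rewrite in_itv.
Qed.

Lemma mean_value_le f df x y m : x <= y ->
  (forall t, x <= t <= y -> {for t, continuous f}) ->
  (forall t, x < t < y -> is_derive t 1 f (df t)) ->
  (forall t, x < t < y -> df t <= m) -> f y - f x <= m * (y - x).
Proof.
rewrite le_eqVlt => /predU1P[->|xy]; first by rewrite !subrr mulr0.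
move=> /pointwise_within cf dfP le_m.
have dfI t : t \in `]x, y[ -> is_derive t 1 f (df t).
  by rewrite in_itv /= => /dfP.
have [z] := MVT xy dfI cf.
rewrite in_itv /= => /le_m zm ->.
by rewrite ler_pM2r// subr_gt0.
Qed.

Lemma mean_value_ge f df x y m : x <= y ->
  (forall t, x <= t <= y -> {for t, continuous f}) ->
  (forall t, x < t < y -> is_derive t 1 f (df t)) ->
  (forall t, x < t < y -> m <= df t) -> m * (y - x) <= f y - f x.
Proof.
move=> xy cf dfP ge_m.
have := @mean_value_le (- f) (- df) x y (- m) xy.
rewrite !fctE mulNr opprK => h.
suff : - f y + f x <= - (m * (y - x)) by lra.
apply: h => t ti.
- by apply: continuousN; apply: cf.
- by apply: is_deriveN; apply: dfP.
- by rewrite lerN2 ge_m.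
Qed.

(** The point is the supremum of the set where [k <= 0]; positivity there would persist nearby and
    contradict the supremum. Applied to [a], it gives the left end of a component of [{a > 0}]. *)
Lemma last_nonpositive k x y :
  (forall t, x <= t <= y -> {for t, continuous k}) -> x <= y ->
  k x <= 0 -> 0 < k y ->
  exists l, [/\ x <= l < y, k l <= 0 & forall t, l < t <= y -> 0 < k t].
Proof.
move=> ck xy kx ky; pose S := [set t | x <= t <= y /\ k t <= 0].
have Sx : S x by split=> //; rewrite lexx.
have hS : has_sup S.
  by split; [exists x|exists y => t [/andP[]]].
have ub t : S t -> t <= sup S by apply/ub_le_sup; case: hS.
have ls : sup S <= y by apply: ge_sup => [|t [/andP[]]//]; exists x.
have xs : x <= sup S by apply: ub.
have ks : k (sup S) <= 0.
  rewrite leNgt; apply/negP => ks0.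
  have /continuous_atP/(_ _ ks0)[d d0 hd] := ck (sup S) (introT andP (conj xs ls)).
  have [t St ht] := sup_adherent d0 hS.
  have ts := ub t St; case: St => _ kt.
  have : `|t - sup S| < d by rewrite ler0_norm; lra.
  by move=> /hd; rewrite ltr_norml => /andP[]; lra.
exists (sup S); split=> //.
  by rewrite xs lt_neqAle ls andbT; apply: contraTneq ky => <-; rewrite -leNgt.
move=> t /andP[st ty]; rewrite ltNge; apply/negP => kt.
suff /ub : S t by rewrite leNgt st.
by split=> //; rewrite ty (le_trans xs (ltW st)).
Qed.

End RealAnalysis.

(** * Second-order jets *)

Section Jets.
Variable R : realType.
Implicit Types (u v f k : R -> R) (x y z l m p C D K : R).

(** The inequality has no little-o term, so the quadratic is itself an admissible test function; its
    second derivative is [2 * C]. *)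
Definition lower_jet u z p C := exists2 d : R, 0 < d &
  forall y, `|y - z| < d -> u z + p * (y - z) + C * (y - z) ^+ 2 <= u y.

Definition upper_jet u z p C := exists2 d : R, 0 < d &
  forall y, `|y - z| < d -> u y <= u z + p * (y - z) + C * (y - z) ^+ 2.

Lemma lower_jetN u z p C : lower_jet (- u) z p C <-> upper_jet u z (- p) (- C).
Proof.
by split=> -[d d0 h]; exists d => // y /h; rewrite !fctE; lra.
Qed.

Lemma exists_smaller (d1 d2 : R) : 0 < d1 -> 0 < d2 ->
  exists t : R, [/\ 0 < t, t < d1 & t < d2].
Proof.
move=> d10 d20; exists (Num.min d1 d2 / 2).
have [h|h] := leP d1 d2; split; lra.
Qed.

(** If [p > m], the linear gap [(p - m) * t] beats [|C| * t ^ 2] for small [t > 0]. Only points to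
    the right of [z] are tested. *)
Lemma lower_jet_le_slope u z p C m (d : R) : 0 < d ->
  (forall y, z < y < z + d -> u y - u z <= m * (y - z)) ->
  lower_jet u z p C -> p <= m.
Proof.
move=> d0 hm [d' d'0 hp]; rewrite leNgt; apply/negP => mp.
have C0 : 0 < `|C| + 1 by rewrite ltr_wpDl.
have e0 : 0 < (p - m) / (2 * (`|C| + 1)) by rewrite divr_gt0//; lra.
have [s [s0 sd sd']] := exists_smaller d0 d'0.
have [t [t0 ts te]] := exists_smaller s0 e0.
have := hm (z + t); have := hp (z + t).
rewrite (_ : z + t - z = t); last by ring.
rewrite gtr0_norm// => /(_ (lt_trans ts sd')) h1 h2.
have {}h2 := h2 ltac:(lra).
have {}te : t * (2 * (`|C| + 1)) < p - m.
  by rewrite -ltr_pdivlMr; lra.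
have : - C <= `|C| by rewrite -normrN ler_norm.
move=> hC; have : (p - m) * t <= `|C| * t * t by nra.
have : 0 <= `|C| by [].
nra.
Qed.

Lemma lower_jet_ge_slope u z p C m (d : R) : 0 < d ->
  (forall y, z - d < y < z -> u y - u z <= m * (y - z)) ->
  lower_jet u z p C -> m <= p.
Proof.
move=> d0 hm [d' d'0 hp].
rewrite -lerN2.
apply: (@lower_jet_le_slope (fun t => u (2 * z - t)) z (- p) C (- m) d) => //.
  move=> y hy; rewrite (_ : 2 * z - z = z); last by ring.
  by have := hm (2 * z - y) ltac:(lra); lra.
exists d' => // y yz; rewrite (_ : 2 * z - z = z); last by ring.
have := hp (2 * z - y).
rewrite (_ : 2 * z - y - z = - (y - z)); last by ring.
rewrite normrN => /(_ yz); lra.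
Qed.

Lemma lower_jet_is_derive u z p C D :
  is_derive z 1 u D -> lower_jet u z p C -> p = D.
Proof.
move=> /is_derive_smallP du jp; apply/eqP; rewrite eq_le; apply/andP; split.
  apply/ler_addgt0Pr => e e0; have [d d0 hd] := du e e0.
  apply: (lower_jet_le_slope d0 _ jp) => y yz.
  have := hd y; rewrite gtr0_norm ?subr_gt0; last by lra.
  by move=> /(_ ltac:(lra)); rewrite ler_norml; lra.
apply/ler_addgt0Pr => e e0; have [d d0 hd] := du e e0.
rewrite -lerBlDr; apply: (lower_jet_ge_slope d0 _ jp) => y yz.
have := hd y; rewrite ltr0_norm ?subr_lt0; last by lra.
by move=> /(_ ltac:(lra)); rewrite ler_norml; lra.
Qed.

Lemma upper_jet_is_derive u z p C D :
  is_derive z 1 u D -> upper_jet u z p C -> p = D.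
Proof.
move=> du jp; have /is_deriveN du' := du.
apply: oppr_inj; apply: (lower_jet_is_derive (C := - C) du').
by apply/lower_jetN; rewrite !opprK.
Qed.

(* The touching function is [m t - K / (t - x)] up to a constant: it excludes a
   minimum near [x], and the excess growth of [u] excludes one at [y]. *)
Lemma lower_jet_mean_value u x y m : x < y ->
  (forall t, x <= t <= y -> {for t, continuous u}) ->
  m * (y - x) < u y - u x ->
  exists z p C, [/\ x < z < y, m < p & lower_jet u z p C].
Proof.
move=> xy cu hm; pose g t := u t - m * t.
have cg t : x <= t <= y -> {for t, continuous g}.
  move=> ti; apply: continuousB; first exact: cu.
  by apply: continuousM; [exact: cst_continuous|].
(* The penalty [K / (t - x)] is [G] at [x + s] and [3 * G] at [x + s / 3], while [g] varies by less
   than [G] on that range and [g y = g x + 3 * G]. Hence [x + s] beats both ends and the minimum is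
   interior. *)
pose G := (u y - u x - m * (y - x)) / 3.
have G0 : 0 < G by rewrite /G; lra.
have /continuous_atP/(_ _ G0)[d d0 hd] := cg x ltac:(lra).
have yx0 : 0 < y - x by lra.
have [s [s0 sy sd]] := exists_smaller yx0 d0.
pose K := G * s; pose F t := g t + K / (t - x).
have K0 : 0 < K by rewrite mulr_gt0.
have xs : x + s / 3 <= y by lra.
have [|z zi zm] := @EVT_min_pointwise _ F (x + s / 3) y xs.
  move=> t ti; apply: continuousD; first by apply: cg; lra.
  apply: continuousM; first exact: cst_continuous.
  apply: continuousV; first by rewrite gt_eqF//; lra.
  by apply: continuousB => //; exact: cst_continuous.
have Fs : F (x + s) < g x + 2 * G.
  have := hd (x + s); rewrite /F (_ : x + s - x = s); last by ring.
  rewrite /K mulfK ?gt_eqF// gtr0_norm// => /(_ sd).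
  by rewrite ltr_norml; lra.
have F3 : g x + 2 * G < F (x + s / 3).
  have := hd (x + s / 3); rewrite /F (_ : x + s / 3 - x = s / 3); last by ring.
  have -> : K / (s / 3) = 3 * G by rewrite /K; field; rewrite gt_eqF.
  rewrite gtr0_norm; last by lra.
  move=> /(_ ltac:(lra)).
  by rewrite ltr_norml; lra.
have Fy : g x + 2 * G < F y.
  suff : 0 < K / (y - x) by rewrite /F /g /G; lra.
  by rewrite divr_gt0.
have zx : x + s / 3 < z.
  rewrite lt_neqAle; case/andP: zi => -> _; rewrite andbT.
  by apply/eqP => zE; have := zm (x + s) ltac:(lra); rewrite -zE; lra.
have zy : z < y.
  rewrite lt_neqAle; case/andP: zi => _ ->; rewrite andbT.
  by apply/eqP => zE; have := zm (x + s) ltac:(lra); rewrite zE; lra.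
pose D := z - x; have D0 : 0 < D by rewrite /D; lra.
exists z, (m + K / D ^+ 2), (- (2 * K / D ^+ 3)); split; first by lra.
  by rewrite ltrDl divr_gt0// exprn_gt0.
have d10 : 0 < z - (x + s / 3) by lra.
have d20 : 0 < y - z by lra.
have [r [r0 r1 r2]] := exists_smaller d10 d20.
have d30 : 0 < D / 2 by lra.
have [q [q0 q1 q2]] := exists_smaller r0 d30.
exists q => // t; rewrite ltr_norml => tz.
have := zm t ltac:(lra); rewrite /F /g -/D => Ft.
(* The Taylor coefficient at [z] is [K / D ^ 3]; doubling it absorbs the remainder as long as
   [|t - z| < D / 2]. *)
have : K / (t - x) <= K / D - K / D ^+ 2 * (t - z) + 2 * K / D ^+ 3 * (t - z) ^+ 2.
  have tE : t - x = D + (t - z) by rewrite /D; ring.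
  rewrite tE; set h := t - z; have hD : 0 < D + 2 * h by rewrite /h; lra.
  have hD' : 0 < D + h by lra.
  rewrite -subr_ge0.
  have -> : K / D - K / D ^+ 2 * h + 2 * K / D ^+ 3 * h ^+ 2 - K / (D + h) =
     K * (h ^+ 2 * (D + 2 * h)) / (D ^+ 3 * (D + h)).
    by field; rewrite !gt_eqF.
  apply: divr_ge0; apply: mulr_ge0; [exact: ltW| |exact/exprn_ge0/ltW|exact: ltW].
  by apply: mulr_ge0; [exact: sqr_ge0|exact: ltW].
lra.
Qed.

Definition concave_on (lo hi : R) k := forall x y w,
  lo < x -> x < y -> y < w -> w < hi ->
  k x * (w - y) + k w * (y - x) <= k y * (w - x).

(** If [k] dips below a chord, subtract the chord and add a bump of second derivative [- 2 * e]
    vanishing at both ends. The result still has an interior minimum, where [u] gets a lower jet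
    with [2 * C = K + 2 * e]. *)
Lemma concave_of_lower_jets u (lo hi : R) K :
  (forall t, lo < t < hi -> {for t, continuous u}) ->
  (forall z p C, lo < z < hi -> lower_jet u z p C -> 2 * C <= K) ->
  concave_on lo hi (fun t => u t - K / 2 * t ^+ 2).
Proof.
move=> cu jK x y w lx xy yw wh; pose k t := u t - K / 2 * t ^+ 2.
suff : k x * (w - y) + k w * (y - x) <= k y * (w - x) by [].
rewrite leNgt; apply/negP => hk.
have wx0 : 0 < w - x by lra.
pose s := (k w - k x) / (w - x).
have sE : s * (w - x) = k w - k x by rewrite /s divfK// gt_eqF.
(* With this [e] the bump fills exactly half of the dip at [y]. *)
pose e := (k x + s * (y - x) - k y) / (2 * ((y - x) * (w - y))).
have P0 : 0 < (y - x) * (w - y) by rewrite mulr_gt0; lra.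
have N0 : 0 < k x + s * (y - x) - k y.
  by rewrite -(pmulr_lgt0 _ wx0); nra.
have e0 : 0 < e by rewrite divr_gt0; lra.
have eE : e * ((y - x) * (w - y)) = (k x + s * (y - x) - k y) / 2.
  by rewrite /e; field; rewrite !gt_eqF //; lra.
pose F t := k t - s * t - e * ((t - x) * (t - w)).
have xw : x <= w by lra.
have [|z zi zm] := @EVT_min_pointwise _ F x w xw.
  move=> t ti.
  have cid : {for t, continuous (@id R)} by [].
  have cc (c : R) : {for t, continuous (fun=> c)} by exact: cst_continuous.
  apply: continuousB; first apply: continuousB; first apply: continuousB.
  - by apply: cu; lra.
  - by apply: continuousM => //; exact: exprn_continuous.
  - exact: continuousM.
  - by apply: continuousM => //; apply: continuousM; apply: continuousB.
have Fy : F y < F x.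
  by rewrite /F; nra.
have Fw : F w = F x by rewrite /F; nra.
have zx : x < z.
  rewrite lt_neqAle; case/andP: zi => -> _; rewrite andbT.
  by apply/eqP => zE; have := zm y ltac:(lra); rewrite -zE; lra.
have zw : z < w.
  rewrite lt_neqAle; case/andP: zi => _ ->; rewrite andbT.
  by apply/eqP => zE; have := zm y ltac:(lra); rewrite zE; lra.
have : 2 * (K / 2 + e) <= K.
  apply: (jK z (K * z + s + e * (2 * z - x - w))); first by lra.
  have d10 : 0 < z - x by lra.
  have d20 : 0 < w - z by lra.
  have [r [r0 r1 r2]] := exists_smaller d10 d20.
  exists r => // t; rewrite ltr_norml => tz.
  by have := zm t ltac:(lra); rewrite /F /k; lra.
lra.
Qed.

(** A parabola centred at [s] that reaches height [3 * w] at distance [d] outweighs the oscillation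
    [w], so the penalised function has a minimum strictly inside the interval. *)
Lemma lower_jet_of_oscillation u (s p d w : R) : 0 < d -> 0 < w ->
  (forall t, `|t - s| <= d -> {for t, continuous u}) ->
  (forall t, `|t - s| <= d -> `|u t - u s - p * (t - s)| <= w) ->
  exists2 z, `|z - s| < d &
    lower_jet u z (p - 2 * (3 * w / d ^+ 2) * (z - s)) (- (3 * w / d ^+ 2)).
Proof.
move=> d0 w0 cu hw; set B := 3 * w / d ^+ 2.
have BE : B * d ^+ 2 = 3 * w by rewrite /B divfK// expf_eq0/= gt_eqF.
pose F t := u t - p * t + B * ((t - s) * (t - s)).
have sd : s - d <= s + d by lra.
have [|z zi zm] := @EVT_min_pointwise _ F (s - d) (s + d) sd.
  move=> t ti.
  have cid : {for t, continuous (@id R)} by [].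
  have cc (c : R) : {for t, continuous (fun=> c)} by exact: cst_continuous.
  apply: continuousD; first apply: continuousB.
  - by apply: cu; rewrite ler_norml; lra.
  - exact: continuousM.
  - by apply: continuousM => //; apply: continuousM; apply: continuousB.
have Fs := zm s ltac:(lra).
have zx : s - d < z.
  rewrite lt_neqAle; case/andP: zi => -> _; rewrite andbT.
  apply/eqP => zE; move: Fs; have := hw z.
  rewrite /F -zE (_ : s - d - s = - d); last by ring.
  by rewrite normrN gtr0_norm// lexx ler_norml -expr2 sqrrN BE => /(_ isT); lra.
have zw : z < s + d.
  rewrite lt_neqAle; case/andP: zi => _ ->; rewrite andbT.
  apply/eqP => zE; move: Fs; have := hw z.
  rewrite /F zE (_ : s + d - s = d); last by ring.
  by rewrite gtr0_norm// lexx ler_norml -expr2 BE => /(_ isT); lra.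
exists z; first by rewrite ltr_norml; lra.
have d10 : 0 < z - (s - d) by lra.
have d20 : 0 < s + d - z by lra.
have [r [r0 r1 r2]] := exists_smaller d10 d20.
exists r => // t; rewrite ltr_norml => tz.
by have := zm t ltac:(lra); rewrite /F; lra.
Qed.

End Jets.

(** * Semiconcavity and regularity *)

Section Regularity.
Variable R : realType.
Implicit Types (u v f k : R -> R) (x y z l m p C D K lo hi : R).

(* If the left and right slopes differed at [z], a line of intermediate slope
   would touch [k] from above with arbitrarily negative second-order term. *)
Lemma concave_is_derive k lo hi z : concave_on lo hi k -> lo < z < hi ->
  (forall p, exists N : R, forall C, upper_jet k z p C -> N <= C) ->
  exists D, is_derive z 1 k D.
Proof.
move=> ck /andP[lz zh] noj.
(* Chord slopes of a concave function increase as [w] decreases to [z], so the supremum of [S] is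
   the right derivative. *)
pose S := [set (k w - k z) / (w - z) | w in [set w | z < w < hi]].
have left_right x w : lo < x < z -> z < w < hi ->
    (k w - k z) / (w - z) <= (k z - k x) / (z - x).
  move=> hx hw; rewrite ler_pdivrMr ?subr_gt0; last by lra.
  rewrite mulrAC ler_pdivlMr ?subr_gt0; last by lra.
  by have := ck x z w ltac:(lra) ltac:(lra) ltac:(lra) ltac:(lra); lra.
have hS : has_sup S.
  split; first by exists ((k ((z + hi) / 2) - k z) / ((z + hi) / 2 - z)),
     ((z + hi) / 2) => //=; lra.
  exists ((k z - k ((lo + z) / 2)) / (z - (lo + z) / 2)) => _ [w /= hw <-].
  by apply: left_right => //; lra.
pose D := sup S; exists D.
have rightD w : z < w < hi -> k w - k z <= D * (w - z).
  move=> hw; rewrite -ler_pdivrMr ?subr_gt0; last by lra.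
  by apply: ub_le_sup; [case: hS|exists w].
have leftD x : lo < x < z -> D * (z - x) <= k z - k x.
  move=> hx; rewrite -ler_pdivlMr ?subr_gt0; last by lra.
  by apply: ge_sup => [|_ [w /= hw <-]]; [case: hS|exact: left_right].
apply/is_derive_smallP => e e0.
have [_ [w0 /= hw0 <-] ] := sup_adherent e0 hS.
rewrite -/D ltr_pdivlMr ?subr_gt0; last by lra.
move=> w0D.
have [x0 hx0 x0D] : exists2 x0, lo < x0 < z & k z - k x0 <= (D + e) * (z - x0).
  apply: contrapT => /forall2NP nx.
  have {}nx x : lo < x < z -> (D + e) * (z - x) < k z - k x.
    by move=> hx; have [//|/negP] := nx x; rewrite -ltNge.
  have [N hN] := noj (D + e / 2).
  suff /hN : upper_jet k z (D + e / 2) (- (`|N| + 1)).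
    by have := ler_norm (- N); rewrite normrN; lra.
  have d10 : 0 < z - lo by lra.
  have d20 : 0 < hi - z by lra.
  have [r [r0 r1 r2]] := exists_smaller d10 d20.
  have N0 : 0 < `|N| + 1 by rewrite ltr_wpDl.
  have d30 : 0 < e / 2 / (`|N| + 1) by rewrite divr_gt0; lra.
  have [q [q0 qr]] := exists_smaller r0 d30.
  rewrite ltr_pdivlMr// => qe.
  exists q => // y; rewrite ltr_norml => yz.
  have [zy|yz'|->] := ltgtP z y.
  - have := rightD y ltac:(lra).
    have : (y - z) * (`|N| + 1) <= e / 2 by nra.
    by set A := `|N| + 1; move: zy; clear; nra.
  - have := nx y ltac:(lra).
    have : (z - y) * (`|N| + 1) <= e / 2 by nra.
    by set A := `|N| + 1; move: yz'; clear; nra.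
  - by rewrite subrr expr2 !mulr0 !addr0.
have d10 : 0 < z - x0 by lra.
have d20 : 0 < w0 - z by lra.
have [r [r0 r1 r2]] := exists_smaller d10 d20.
exists r => // y; rewrite ltr_norml => yz.
have [zy|yz'|->] := ltgtP z y.
- rewrite (gtr0_norm (x := y - z)); last by lra.
  have := rightD y ltac:(lra); rewrite ler_norml => h1.
  have h2 := ck z y w0 ltac:(lra) zy ltac:(lra) ltac:(lra).
  have : (D - e) * (y - z) <= k y - k z; last by lra.
  by rewrite -(ler_pM2r d20); nra.
- rewrite (ltr0_norm (x := y - z)); last by lra.
  have := leftD y ltac:(lra); rewrite ler_norml => h1.
  have h2 := ck x0 y z ltac:(lra) ltac:(lra) yz' ltac:(lra).
  have : k z - k y <= (D + e) * (z - y); last by lra.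
  by rewrite -(ler_pM2r d10); nra.
- by rewrite !subrr mulr0 subrr normr0 mulr0.
Qed.

Lemma concave_le_tangent k lo hi z y D : concave_on lo hi k -> lo < z < hi ->
  lo < y < hi -> is_derive z 1 k D -> k y <= k z + D * (y - z).
Proof.
move=> ck hz hy /is_derive_smallP dk.
have [zy|yz|->] := ltgtP z y; last by rewrite subrr mulr0 addr0.
- have yz0 : 0 < y - z by lra.
  suff : (k y - k z) / (y - z) <= D by rewrite ler_pdivrMr//; lra.
  apply/ler_addgt0Pr => e e0; rewrite ler_pdivrMr//.
  have [d d0 hd] := dk e e0.
  have [s [s0 sd sy]] := exists_smaller d0 yz0.
  have := hd (z + s); rewrite (_ : z + s - z = s); last by ring.
  rewrite gtr0_norm// ler_norml => /(_ sd) h1.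
  have := ck z (z + s) y ltac:(lra) ltac:(lra) ltac:(lra) ltac:(lra).
  have : (k (z + s) - k z) * (y - z) <= (D + e) * s * (y - z).
    by rewrite ler_pM2r//; lra.
  by move=> h2 h3; rewrite -(ler_pM2r s0); lra.
- have yz0 : 0 < z - y by lra.
  suff : D <= (k z - k y) / (z - y) by rewrite ler_pdivlMr//; lra.
  apply/ler_addgt0Pr => e e0; rewrite -lerBlDr ler_pdivlMr//.
  have [d d0 hd] := dk e e0.
  have [s [s0 sd sy]] := exists_smaller d0 yz0.
  have := hd (z - s); rewrite (_ : z - s - z = - s); last by ring.
  rewrite normrN gtr0_norm// ler_norml => /(_ sd) h1.
  have := ck y (z - s) z ltac:(lra) ltac:(lra) ltac:(lra) ltac:(lra).
  have : (D - e) * s * (z - y) <= (k z - k (z - s)) * (z - y).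
    by rewrite ler_pM2r//; lra.
  by move=> h2 h3; rewrite -(ler_pM2r s0); lra.
Qed.

(** The tangent inequality at [t], evaluated at fixed points [z + q] and [z - q], traps [f t]
    between two difference quotients that vary continuously with [t]. *)
Lemma concave_derivative_continuous k f lo hi z : concave_on lo hi k ->
  (forall t, lo < t < hi -> is_derive t 1 k (f t)) -> lo < z < hi ->
  {for z, continuous f}.
Proof.
move=> ck dk hz; apply/continuous_atP => e e0.
have dz := dk z hz; have /is_derive_smallP/(_ (e / 2))[|d d0 hd] := dz; first by lra.
have near_z y c : 0 < k y - k z - c * (y - z) ->
    exists2 r : R, 0 < r & forall t, `|t - z| < r -> 0 < k y - k t - c * (y - t).
  move=> pos; pose g t := k y - k t - c * (y - t).
  have cg : {for z, continuous g}.
    apply: continuousB; first apply: continuousB.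
    - exact: cst_continuous.
    - exact: is_derive_continuous dz.
    - apply: continuousM; first exact: cst_continuous.
      by apply: continuousB => //; exact: cst_continuous.
  have /continuous_atP/(_ _ pos)[r r0 hr] := cg.
  by exists r => // t /hr; rewrite ltr_norml /g; lra.
have d10 : 0 < z - lo by lra.
have d20 : 0 < hi - z by lra.
have [s [s0 s1 s2]] := exists_smaller d10 d20.
have [q [q0 qs qd]] := exists_smaller s0 d0.
have [|r1 r10 hr1] := near_z (z + q) (f z - e).
  have := hd (z + q); rewrite (_ : z + q - z = q); last by ring.
  by rewrite gtr0_norm// ler_norml => /(_ qd); nra.
have [|r2 r20 hr2] := near_z (z - q) (f z + e).
  have := hd (z - q); rewrite (_ : z - q - z = - q); last by ring.
  by rewrite normrN gtr0_norm// ler_norml => /(_ qd); nra.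
have [r [r0 rr1 rr2]] := exists_smaller r10 r20.
have [w [w0 wr wq]] := exists_smaller r0 q0.
exists w => // t tz.
have h1 := hr1 t (lt_trans (lt_trans tz wr) rr1).
have h2 := hr2 t (lt_trans (lt_trans tz wr) rr2).
move: tz; rewrite !ltr_norml => tz.
have dt := dk t ltac:(lra).
have := concave_le_tangent ck (z := t) (y := z + q) ltac:(lra) ltac:(lra) dt.
have := concave_le_tangent ck (z := t) (y := z - q) ltac:(lra) ltac:(lra) dt.
move=> g2 g1.
apply/andP; split.
  have : 0 < z + q - t by lra.
  by nra.
have : 0 < t - (z - q) by lra.
by nra.
Qed.

Lemma parabola_is_derive K x :
  is_derive x 1 (fun t => K / 2 * t ^+ 2) (K * x).
Proof.
apply/is_derive_smallP => e e0.
have A0 : 0 < `|K / 2| + 1 by rewrite ltr_wpDl.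
exists (e / (`|K / 2| + 1)) => [|y]; first by rewrite divr_gt0.
rewrite ltr_pdivlMr// => yx.
rewrite (_ : _ - _ - _ = K / 2 * ((y - x) * (y - x))); last by field.
rewrite normrM (normrM (y - x)) mulrA ler_wpM2r//.
by have := normr_ge0 (y - x); lra.
Qed.

Lemma derive1_of_jets u lo hi K :
  (forall t, lo < t < hi -> {for t, continuous u}) ->
  (forall z p C, lo < z < hi -> lower_jet u z p C -> 2 * C <= K) ->
  (forall z p, lo < z < hi -> exists N : R, forall C, upper_jet u z p C -> N <= C) ->
  forall z, lo < z < hi ->
    is_derive z 1 u (derive1 u z) /\ {for z, continuous (derive1 u)}.
Proof.
move=> cu lj uj; have ck := concave_of_lower_jets cu lj.
set k := (fun t => u t - K / 2 * t ^+ 2) in ck.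
have dk z : lo < z < hi -> is_derive z 1 k (derive1 u z - K * z)
    /\ is_derive z 1 u (derive1 u z).
  move=> hz; have [|D dD] := concave_is_derive ck hz.
    (* Adding back the parabola turns an upper jet [(p, C)] of [k] at [z] into the upper jet
       [(p + K * z, C + K / 2)] of [u]. *)
    move=> p; have [N hN] := uj z (p + K * z) hz; exists (N - K / 2) => C [d d0 hd].
    rewrite lerBlDr; apply: hN; exists d => // y /hd; rewrite /k; lra.
  have du : is_derive z 1 u (D + K * z).
    have := is_deriveD dD (parabola_is_derive K z).
    by congr (is_derive _ _ _ _); apply/funext => t; rewrite /k !fctE; ring.
  have E : derive1 u z = D + K * z by rewrite derive1E; case: du.
  by rewrite E addrK.
move=> z hz; split; first by have [] := dk z hz.
have cf : {for z, continuous (fun t => derive1 u t - K * t)}.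
  apply: (concave_derivative_continuous ck _ hz) => t ht.
  by have [] := dk t ht.
have -> : derive1 u = (fun t => derive1 u t - K * t) \+ (fun t => K * t).
  by apply/funext => t /=; rewrite subrK.
apply: continuousD cf _.
by apply: continuousM => //; exact: cst_continuous.
Qed.

(** Adding the tangent inequalities of the concave function [k] at [x] and at [y] shows that its
    derivative [f t - K * t] does not increase. *)
Lemma derivative_increment_le u f lo hi K x y :
  (forall t, lo < t < hi -> is_derive t 1 u (f t)) ->
  (forall z p C, lo < z < hi -> lower_jet u z p C -> 2 * C <= K) ->
  lo < x -> x < y -> y < hi -> f y - f x <= K * (y - x).
Proof.
move=> du lj lx xy yh.
have ck := @concave_of_lower_jets R u lo hi K _ lj.
have {}ck := ck (fun t ht => is_derive_continuous (du t ht)).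
set k := (fun t => u t - K / 2 * t ^+ 2) in ck.
have dk z : lo < z < hi -> is_derive z 1 k (f z - K * z).
  by move=> hz; exact: (is_deriveB (du z hz) (parabola_is_derive K z)).
have hx : lo < x < hi by lra.
have hy : lo < y < hi by lra.
have := concave_le_tangent ck hx hy (dk x hx).
have := concave_le_tangent ck hy hx (dk y hy).
have yx : 0 < y - x by lra.
by nra.
Qed.

Lemma derivative_increment_ge u f lo hi K x y :
  (forall t, lo < t < hi -> is_derive t 1 u (f t)) ->
  (forall z p C, lo < z < hi -> upper_jet u z p C -> K <= 2 * C) ->
  lo < x -> x < y -> y < hi -> K * (y - x) <= f y - f x.
Proof.
move=> du uj lx xy yh.
have : (- f) y - (- f) x <= (- K) * (y - x); last by rewrite !fctE; lra.
apply: (@derivative_increment_le (- u) (- f) lo hi) => //.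
  by move=> t ht; apply: is_deriveN; exact: du.
by move=> z p C hz /lower_jetN/(uj _ _ _ hz); lra.
Qed.

(** Jets with [2 * C] within [e] of [q] trap the increments of [f] near [z] between slopes [q - e]
    and [q + e]. *)
Lemma second_derivative_of_jets u f z (q r : R) : 0 < r ->
  (forall t, z - r < t < z + r -> is_derive t 1 u (f t)) ->
  (forall e : R, 0 < e -> exists2 d : R, 0 < d & forall t p C, `|t - z| < d ->
     (lower_jet u t p C -> 2 * C <= q + e) /\
     (upper_jet u t p C -> q - e <= 2 * C)) ->
  is_derive z 1 f q.
Proof.
move=> r0 du hq; apply/is_derive_smallP => e e0.
have [d d0 hd] := hq e e0; have [s [s0 sr sd]] := exists_smaller r0 d0.
exists s => // y; rewrite ltr_norml => yz.
have du' t : z - s < t < z + s -> is_derive t 1 u (f t).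
  by move=> ht; apply: du; lra.
have inc x w : z - s < x -> x < w -> w < z + s ->
    (q - e) * (w - x) <= f w - f x <= (q + e) * (w - x).
  move=> h1 h2 h3; apply/andP; split.
    apply: (derivative_increment_ge du') => // t p C ht.
    by have [] := hd t p C _; rewrite ?ltr_norml//; lra.
  apply: (derivative_increment_le du') => // t p C ht.
  by have [] := hd t p C _; rewrite ?ltr_norml//; lra.
rewrite ler_norml; have [zy|yz'|->] := ltgtP z y.
- rewrite (gtr0_norm (x := y - z)); last by lra.
  by have := inc z y ltac:(lra) zy ltac:(lra); lra.
- rewrite (ltr0_norm (x := y - z)); last by lra.
  by have := inc y z ltac:(lra) yz' ltac:(lra); lra.
- by rewrite !subrr normr0 !mulr0 subrr oppr0 lexx.
Qed.

End Regularity.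

(** * Differential inequalities with a quadratic singularity *)

Section SingularODE.
Variable R : realType.
Implicit Types (u f df h dh : R -> R) (l s q c r t x : R).

(** A maximum of [f] over [[t, s]] has value at least [q]; at a point right of [t] the derivative
    would be negative and [f] larger just to the left. So the maximum is at [t]. *)
Lemma backward_ge f df l s q : l < s ->
  (forall t, l < t <= s -> is_derive t 1 f (df t)) ->
  (forall t, l < t <= s -> q <= f t -> df t < 0) -> q <= f s ->
  forall t, l < t <= s -> q <= f t.
Proof.
move=> ls dfP neg qs t ht.
have cNf x : t <= x <= s -> {for x, continuous (- f)}.
  by move=> hx; apply: continuousN; apply/is_derive_continuous/dfP; lra.
have [|z zi zm] := @EVT_min_pointwise _ (- f) t s _ cNf; first by lra.
have {}zm x : t <= x <= s -> f x <= f z by move=> /zm; rewrite !fctE lerN2.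
have [zt|tz] := leP z t.
  have zE : z = t by lra.
  by move: zm; rewrite zE => zm; rewrite (le_trans qs)// zm//; lra.
have qz : q <= f z by rewrite (le_trans qs)// zm//; lra.
have hz : l < z <= s by lra.
have dz := neg z hz qz.
have /is_derive_smallP/(_ (- df z / 2))[|d d0 hd] := dfP z hz; first by lra.
have tz0 : 0 < z - t by lra.
have [h [h0 hd1 ht1]] := exists_smaller d0 tz0.
have := hd (z - h); rewrite (_ : z - h - z = - h); last by ring.
rewrite normrN gtr0_norm// ler_norml => /(_ hd1).
have := zm (z - h) ltac:(lra).
by nra.
Qed.

(** Once [f >= q] on the whole interval, the derivative is at most [- c / (4 * r ^ 2)] between
    [l + r] and [l + 2 * r]; over this length [r] the gain is [c / (4 * r)]. *)
Lemma blowup_left f df l s c q : l < s -> 0 < c ->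
  (forall t, l < t <= s -> is_derive t 1 f (df t)) ->
  (forall t, l < t <= s -> q <= f t -> df t <= - (c / (t - l) ^+ 2)) ->
  q <= f s ->
  forall r, 0 < r -> 2 * r <= s - l -> q + c / (4 * r) <= f (l + r).
Proof.
move=> ls c0 dfP dec qs r r0 rs.
have qf : forall t, l < t <= s -> q <= f t.
  apply: (backward_ge ls dfP) => // t ht /(dec t ht) h; apply: le_lt_trans h _.
  by rewrite oppr_lt0 divr_gt0// exprn_gt0//; lra.
have := @mean_value_le _ f df (l + r) (l + 2 * r) (- (c / (2 * r) ^+ 2)) ltac:(lra).
have -> : - (c / (2 * r) ^+ 2) * (l + 2 * r - (l + r)) = - (c / (4 * r)).
  by field; rewrite gt_eqF.
have q2 := qf (l + 2 * r) ltac:(lra).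
move=> h; suff : f (l + 2 * r) - f (l + r) <= - (c / (4 * r)) by lra.
apply: h => t ht.
- by apply/is_derive_continuous/dfP; lra.
- by apply: dfP; lra.
- have ht' : l < t <= s by lra.
  rewrite (le_trans (dec t ht' (qf t ht')))// lerN2.
  rewrite ler_pM2l// lef_pV2 ?posrE ?exprn_gt0//; try lra.
  by rewrite ler_pXn2r// ?nnegrE; lra.
Qed.

(** At the last point with [f >= q] one has [f = q] and a positive derivative, so [f] cannot be
    below [q] just afterwards. *)
Lemma no_downcrossing f df x s q : x <= s ->
  (forall t, x <= t <= s -> is_derive t 1 f (df t)) ->
  (forall t, x <= t <= s -> f t = q -> 0 < df t) -> q <= f x -> q <= f s.
Proof.
move=> xs dfP up qx; rewrite leNgt; apply/negP => sq.
have cf t : x <= t <= s -> {for t, continuous f}.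
  by move=> ht; apply: is_derive_continuous (dfP t ht).
have [|||l [hl kl0 kl]] := @last_nonpositive _ (fun t => q - f t) x s _ xs.
- by move=> t /cf ct; apply: continuousB => //; exact: cst_continuous.
- by rewrite subr_le0.
- by rewrite subr_gt0.
have ls : 0 < s - l by lra.
have hl' : x <= l <= s by lra.
have fl : f l = q.
  apply/eqP; rewrite eq_le; apply/andP; split; last by lra.
  apply/ler_addgt0Pr => e e0.
  have /continuous_atP/(_ e e0)[d d0 hd] := cf l hl'.
  have [h [h0 hd1 hs]] := exists_smaller d0 ls.
  have := hd (l + h); rewrite (_ : l + h - l = h); last by ring.
  rewrite gtr0_norm// ltr_norml => /(_ hd1).
  by have := kl (l + h) ltac:(lra); lra.
have dl := up l hl' fl.
have /is_derive_smallP/(_ (df l / 2))[|d d0 hd] := dfP l hl'; first by lra.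
have [h [h0 hd1 hs]] := exists_smaller d0 ls.
have := hd (l + h); rewrite (_ : l + h - l = h); last by ring.
rewrite gtr0_norm// ler_norml => /(_ hd1).
have := kl (l + h) ltac:(lra).
by nra.
Qed.

(* The primitive of [1 / (t - l)] is unbounded at [l]. *)
Lemma derivative_not_hyperbolic u f l s c q : l < s -> 0 < c ->
  {for l, continuous u} ->
  (forall t, l < t <= s -> is_derive t 1 u (f t)) ->
  ~ (forall r, 0 < r -> 2 * r <= s - l -> q + c / (4 * r) <= f (l + r)).
Proof.
move=> ls c0 cu duf hf.
(* Continuity at [l] bounds the increment of [u] from [l + r / 2] to [l + r] by [c / 16], while the
   lower bound on [f] forces at least [c / 8 + q * r / 2], with [|q| * r < c / 32]. *)
have e0 : 0 < c / 32 by lra.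
have /continuous_atP/(_ _ e0)[d d0 hd] := cu.
have sl : 0 < (s - l) / 2 by lra.
have q0 : 0 < `|q| + 1 by rewrite ltr_wpDl.
have e1 : 0 < c / 32 / (`|q| + 1) by rewrite divr_gt0.
have [r1 [r10 r1d r1s]] := exists_smaller d0 sl.
have [r [r0 rr1]] := exists_smaller r10 e1.
rewrite ltr_pdivlMr// => rq.
have h1 := hd (l + r); rewrite (_ : l + r - l = r) in h1; last by ring.
have h2 := hd (l + r / 2); rewrite (_ : l + r / 2 - l = r / 2) in h2; last by ring.
rewrite gtr0_norm// ltr_norml in h1.
have r20 : 0 < r / 2 by lra.
rewrite gtr0_norm// ltr_norml in h2.
have {}h1 := h1 ltac:(lra).
have {}h2 := h2 ltac:(lra).
have := @mean_value_ge _ u f (l + r / 2) (l + r) (q + c / (4 * r)) ltac:(lra).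
have -> : (q + c / (4 * r)) * (l + r - (l + r / 2)) = q * r / 2 + c / 8.
  by field; rewrite gt_eqF.
move=> h; suff : q * r / 2 + c / 8 <= u (l + r) - u (l + r / 2).
  have : - `|q| <= q by rewrite lerNl -normrN ler_norm.
  by nra.
apply: h => t ht.
- by apply/is_derive_continuous/duf; lra.
- by apply: duf; lra.
- have := hf (t - l) ltac:(lra) ltac:(lra).
  rewrite [l + _]addrC subrK; apply: le_trans.
  rewrite lerD2l ler_pM2l// lef_pV2 ?posrE; lra.
Qed.

(* Below [q'] the function [h] would blow up to the left, and [f >= h] keeps [f]
   from escaping downwards through [q']. *)
Lemma lower_barrier f df h dh l s c q' q : l < s -> 0 < c ->
  (forall t, l < t <= s -> is_derive t 1 f (df t)) ->
  (forall t, l < t <= s -> is_derive t 1 h (dh t)) ->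
  (forall t, l < t <= s -> h t <= f t) ->
  (forall t, l < t <= s -> h t <= q' -> dh t <= - (c / (t - l) ^+ 2)) ->
  (forall t, l < t <= s -> q' <= f t <= q -> c / (t - l) ^+ 2 <= df t) ->
  q' <= q -> q < f s.
Proof.
move=> ls c0 dfP dhP hf hdec finc q'q.
have pos t : l < t -> 0 < c / (t - l) ^+ 2.
  by move=> lt; rewrite divr_gt0// exprn_gt0//; lra.
have small s' b : l < s' <= s -> exists r, [/\ 0 < r, 2 * r <= s' - l & b < c / (4 * r)].
  move=> hs'; have s0 : 0 < (s' - l) / 2 by lra.
  have b0 : 0 < 4 * (`|b| + 1) by rewrite mulr_gt0// ltr_wpDl.
  have e0 : 0 < c / (4 * (`|b| + 1)) by rewrite divr_gt0.
  have [r [r0 rs]] := exists_smaller s0 e0.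
  rewrite ltr_pdivlMr// => rb; exists r; split=> //; first by lra.
  rewrite ltr_pdivlMr; last by lra.
  by have := ler_norm b; nra.
have fq' t : l < t <= s -> q' <= f t.
  move=> ht; rewrite leNgt; apply/negP => ftq'.
  (* The value [q'] can only be crossed upwards, so [f t < q'] persists down to [l]. Then [h <= f]
     stays below [q'], where it must blow up to the left. *)
  have below x : l < x <= t -> f x < q'.
    move=> hx; rewrite ltNge; apply/negP => q'x; move: ftq'; rewrite ltNge => /negP; apply.
    apply: (@no_downcrossing f df x t q') => [|y hy|y hy fy|//]; first by lra.
      by apply: dfP; lra.
    by apply: lt_le_trans (pos y _) (finc y _ _); lra.
  have [r [r0 rs hr]] := small t (q' - h t) ht.
  have lt : l < t by lra.
  have := @blowup_left h dh l t c (h t) lt c0 _ _ (lexx _) r r0 rs.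
  have := below (l + r) ltac:(lra); have := hf (l + r) ltac:(lra).
  move=> h1 h2 h3.
  suff : h t + c / (4 * r) <= h (l + r) by lra.
  apply: h3 => y hy; first by apply: dhP; lra.
  move=> _; apply: hdec; first by lra.
  by have := below y hy; have := hf y ltac:(lra); lra.
(* If [f s <= q], then [- f] blows up to the left starting from [- q], which pushes [f (l + r)]
   below [q']. *)
rewrite ltNge; apply/negP => fsq.
have [r [r0 rs hr]] := small s (q - q') ltac:(lra).
have := @blowup_left (- f) (- df) l s c (- q) ls c0 _ _ _ r r0 rs.
have := fq' (l + r) ltac:(lra).
rewrite !fctE => h1 h2.
suff : - q + c / (4 * r) <= - f (l + r) by lra.
apply: h2 => [y hy|y hy yq|]; last by rewrite lerN2.
  by apply: is_deriveN; exact: dfP.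
rewrite lerN2; apply: finc => //.
by rewrite fq'//=; lra.
Qed.

(** Gronwall with a merely local rate: after the last zero [s], on an interval of length [k] with
    [2 * k * N < 1], the maximum of [|f|] would be at most half of itself. *)
Lemma linear_ode_zero f df x t : x <= t ->
  (forall s, x <= s <= t -> is_derive s 1 f (df s)) ->
  (forall s, x <= s <= t -> exists2 N : R, 0 < N & exists2 r, 0 < r &
     forall y, `|y - s| < r -> `|df y| <= N * `|f y|) ->
  f x = 0 -> f t = 0.
Proof.
move=> xt dfP rate fx; apply/eqP; rewrite -normr_le0 leNgt; apply/negP => ft.
have cnf y : x <= y <= t -> {for y, continuous (fun y => `|f y|)}.
  move=> /dfP/is_derive_continuous cfy; apply: (continuous_comp cfy).
  exact: norm_continuous.
have fx0 : `|f x| <= 0 by rewrite fx normr0.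
have [s [hs fs fpos]] := last_nonpositive cnf xt fx0 ft.
have {}fs : f s = 0 by apply/eqP; rewrite -normr_le0.
have hs' : x <= s <= t by lra.
have [N N0 [r r0 hr]] := rate s hs'.
have n0 : 0 < 1 / (2 * N) by rewrite divr_gt0// mulr_gt0.
have ts0 : 0 < t - s by lra.
have [k1 [k10 k1r k1N]] := exists_smaller r0 n0.
have [k [k0 kk1 kt]] := exists_smaller k10 ts0.
have kN : k * (2 * N) < 1 by rewrite -ltr_pdivlMr ?mulr_gt0//; lra.
have sk : s <= s + k by lra.
have [m hm mmax] : exists2 m, s <= m <= s + k &
    forall y, s <= y <= s + k -> `|f y| <= `|f m|.
  have cN y : s <= y <= s + k -> {for y, continuous (- (fun y => `|f y|))}.
    by move=> hy; apply: continuousN; apply: cnf; lra.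
  have [m hm mm] := EVT_min_pointwise sk cN.
  by exists m => // y /mm; rewrite !fctE lerN2.
have fk : 0 < `|f (s + k)| by apply: fpos; lra.
have fm : 0 < `|f m| by apply: lt_le_trans fk (mmax _ _); lra.
have up y : s < y < m -> `|df y| <= N * `|f m|.
  move=> hy; apply: le_trans (hr y _) _; first by rewrite ltr_norml; lra.
  by rewrite ler_pM2l// mmax//; lra.
have cf y : s <= y <= m -> {for y, continuous f}.
  by move=> hy; apply: is_derive_continuous (dfP y _); lra.
have df' y : s < y < m -> is_derive y 1 f (df y) by move=> hy; apply: dfP; lra.
have sm : s <= m by lra.
have le1 : f m - f s <= N * `|f m| * (m - s).
  by apply: (mean_value_le sm cf df') => y /up; rewrite ler_norml => /andP[].
have ge1 : - (N * `|f m|) * (m - s) <= f m - f s.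
  by apply: (mean_value_ge sm cf df') => y /up; rewrite ler_norml => /andP[].
rewrite fs subr0 in le1 ge1.
have : `|f m| <= N * `|f m| * (m - s) by rewrite ler_norml; lra.
have : N * `|f m| * (m - s) <= N * `|f m| * k by rewrite ler_pM2l ?mulr_gt0//; lra.
have : k * (2 * N) * `|f m| < 1 * `|f m| by rewrite ltr_pM2r.
lra.
Qed.

End SingularODE.

(** * The Hamiltonian and the elliptic region *)

Section Hamiltonian.
Variables (R : realType) (alpha0 alpha1 gamma eta : R) (H : R -> R -> R).
Hypotheses (alpha0_gt0 : 0 < alpha0) (gamma_gt2 : 2 < gamma)
  (HH : H_sqc alpha0 alpha1 gamma eta H).
Implicit Types (f : R -> R) (x y z p q M L : R).

Lemma H_ge x p : - alpha0^-1 <= H x p.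
Proof.
have [h _ _ _ _] := HH; have [h1 _] := h x p.
by have := mulr_ge0 (ltW alpha0_gt0) (powR_ge0 `|p| gamma); lra.
Qed.

Lemma H_coercive (B : R) : exists M, forall x p, H x p <= B -> `|p| <= M.
Proof.
exists (1 + `|B + alpha0^-1| / alpha0) => x p HB.
have A0 : 0 <= `|B + alpha0^-1| / alpha0 by rewrite divr_ge0// ltW.
have [p1|p1] := leP `|p| 1; first by lra.
have [h _ _ _ _] := HH; have [h1 _] := h x p.
have : `|p| <= `|p| `^ gamma.
  by rewrite -[leLHS]powRr1// ler_powR//; have := gamma_gt2; lra.
have := ler_norm (B + alpha0^-1) => h2 h3.
suff : `|p| <= `|B + alpha0^-1| / alpha0 by lra.
by rewrite ler_pdivlMr//; have := alpha0_gt0; nra.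
Qed.

Lemma H_lipschitz_momentum M : exists2 L, 0 < L & forall x p q,
  `|p| <= M -> `|q| <= M -> `|H x p - H x q| <= L * `|p - q|.
Proof.
have [_ h _ _ _] := HH.
exists (`|alpha1| * ((2 * M + 1) `^ (gamma - 1)) + 1) => [|x p q pM qM].
  by rewrite ltr_wpDl// mulr_ge0// powR_ge0.
apply: le_trans (h x p q) _; rewrite ler_wpM2r//.
have h1 : (`|p| + `|q| + 1) `^ (gamma - 1) <= (2 * M + 1) `^ (gamma - 1).
  have := normr_ge0 p; have := normr_ge0 q => q0 p0.
  by apply: ge0_ler_powR; rewrite ?nnegrE; have := gamma_gt2; lra.
have := powR_ge0 (`|p| + `|q| + 1) (gamma - 1).
have := ler_norm alpha1; have := normr_ge0 alpha1.
by nra.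
Qed.

Lemma H_lipschitz_space M : exists2 L, 0 < L & forall x y p,
  `|p| <= M -> `|H x p - H y p| <= L * `|x - y|.
Proof.
have [_ _ h _ _] := HH.
exists (`|alpha1| * (M `^ gamma + 1) + 1) => [|x y p pM].
  by rewrite ltr_wpDl// mulr_ge0// addr_ge0// powR_ge0.
apply: le_trans (h x y p) _; rewrite ler_wpM2r//.
have h1 : `|p| `^ gamma <= M `^ gamma.
  have := normr_ge0 p => p0.
  by apply: ge0_ler_powR; rewrite ?nnegrE; have := gamma_gt2; lra.
have := powR_ge0 `|p| gamma.
have := ler_norm alpha1; have := normr_ge0 alpha1.
by nra.
Qed.

Lemma H_continuous_along f z :
  {for z, continuous f} -> {for z, continuous (fun x => H x (f x))}.
Proof.
move=> cf; have [L L0 hL] := H_lipschitz_momentum (`|f z| + 1).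
have [L' L'0 hL'] := H_lipschitz_space (`|f z| + 1).
apply/continuous_atP => e e0.
have e1 : 0 < e / 2 / L by rewrite divr_gt0//; lra.
have e2 : 0 < e / 2 / L' by rewrite divr_gt0//; lra.
have [e3 [e30 e31 e3L]] := exists_smaller ltr01 e1.
have /continuous_atP/(_ _ e30)[d d0 hd] := cf.
have [r [r0 rd rL]] := exists_smaller d0 e2.
exists r => // y yz; have fy := hd y (lt_trans yz rd).
have fyM : `|f y| <= `|f z| + 1.
  have -> : f y = f z + (f y - f z) by ring.
  by apply: le_trans (ler_normD _ _) _; lra.
have -> : H y (f y) - H z (f z) = (H y (f y) - H y (f z)) + (H y (f z) - H z (f z)).
  by ring.
apply: le_lt_trans (ler_normD _ _) _.
have fzM : `|f z| <= `|f z| + 1 by lra.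
have h1 := hL y (f y) (f z) fyM fzM.
have h2 := hL' y z (f z) fzM.
have g1 : L * `|f y - f z| < e / 2.
  by rewrite mulrC -ltr_pdivlMr//; lra.
have g2 : L' * `|y - z| < e / 2.
  by rewrite mulrC -ltr_pdivlMr//; lra.
lra.
Qed.

Lemma H_momentum_continuous x p : {for p, continuous (H x)}.
Proof.
have [L L0 hL] := H_lipschitz_momentum (`|p| + 1).
apply/continuous_atP => e e0.
have e1 : 0 < e / L by rewrite divr_gt0.
have [r [r0 r1 rL]] := exists_smaller ltr01 e1.
exists r => // q qp.
have qM : `|q| <= `|p| + 1.
  have -> : q = p + (q - p) by ring.
  by apply: le_trans (ler_normD _ _) _; lra.
apply: le_lt_trans (hL x q p qM _) _; first by lra.
by rewrite mulrC -ltr_pdivlMr//; lra.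
Qed.

(** Since [p2] lies between [p1] and [q], strict quasiconvexity puts [H x p2] below the larger end
    value, which cannot be [H x p1]. *)
Lemma H_increasing_right x p1 p2 q :
  p1 < p2 -> H x p1 < H x p2 -> p2 <= q -> H x p2 <= H x q.
Proof.
move=> p12 h12; rewrite le_eqVlt => /predU1P[<-//|p2q].
have [_ _ _ sq _] := HH.
have qp : 0 < q - p1 by lra.
have := sq x p1 q ((q - p2) / (q - p1)).
have -> : (q - p2) / (q - p1) * p1 + (1 - (q - p2) / (q - p1)) * q = p2.
  by field; rewrite gt_eqF.
have p1q : p1 != q by rewrite lt_eqF//; lra.
have t01 : 0 < (q - p2) / (q - p1) < 1.
  apply/andP; split; first by rewrite divr_gt0//; lra.
  by rewrite ltr_pdivrMr//; lra.
move=> /(_ p1q t01); rewrite lt_max => /orP[]; lra.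
Qed.

Lemma H_decreasing_left x p1 p2 q :
  p1 < p2 -> H x p2 < H x p1 -> q <= p1 -> H x p1 <= H x q.
Proof.
move=> p12 h12; rewrite le_eqVlt => /predU1P[<-//|qp1].
have [_ _ _ sq _] := HH.
have qp : 0 < p2 - q by lra.
have := sq x q p2 ((p2 - p1) / (p2 - q)).
have -> : (p2 - p1) / (p2 - q) * q + (1 - (p2 - p1) / (p2 - q)) * p2 = p1.
  by field; rewrite gt_eqF.
have qp2 : q != p2 by rewrite lt_eqF//; lra.
have t01 : 0 < (p2 - p1) / (p2 - q) < 1.
  apply/andP; split; first by rewrite divr_gt0//; lra.
  by rewrite ltr_pdivrMr//; lra.
move=> /(_ qp2 t01); rewrite lt_max => /orP[]; lra.
Qed.

Lemma H_le_between x p1 p2 q (c : R) :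
  p1 <= q <= p2 -> H x p1 <= c -> H x p2 <= c -> H x q <= c.
Proof.
move=> /andP[]; rewrite le_eqVlt => /predU1P[<-//|p1q].
rewrite le_eqVlt => /predU1P[->//|qp2] h1 h2.
rewrite leNgt; apply/negP => cq.
have := H_increasing_right p1q (le_lt_trans h1 cq) (ltW qp2).
by lra.
Qed.

End Hamiltonian.

(** * Viscosity inequalities tested on quadratic jets *)

Section ViscosityJets.
Variable R : realType.
Implicit Types (a u : R -> R) (H : R -> R -> R) (lam z p C : R).

Definition jet_super a H lam u := forall z p C, lower_jet u z p C ->
  a z * (2 * C) + H z p <= lam.

Definition jet_sub a H lam u := forall z p C, upper_jet u z p C ->
  lam <= a z * (2 * C) + H z p.

Lemma quadratic_C2 (c p C z : R) :
  let phi y := c + p * (y - z) + C * (y - z) ^+ 2 in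
  [/\ C2 phi, derive1 phi z = p & derive1n 2 phi z = 2 * C].
Proof.
move=> phi.
have d1 (y : R) : is_derive y 1 phi (p + 2 * C * (y - z)).
  apply/is_derive_smallP => e e0.
  have C0 : 0 < `|C| + 1 by rewrite ltr_wpDl.
  exists (e / (`|C| + 1)) => [|t]; first by rewrite divr_gt0.
  rewrite ltr_pdivlMr// => ty; rewrite /phi.
  rewrite (_ : _ - _ - _ = C * ((t - y) * (t - y))); last by ring.
  rewrite normrM (normrM (t - y)) mulrA ler_wpM2r//.
  by have := normr_ge0 (t - y); lra.
have E1 : derive1 phi = fun y => p + 2 * C * (y - z).
  by apply/funext => y; rewrite derive1E; have [_ ->] := d1 y.
have d2 (y : R) : is_derive y 1 (derive1 phi) (2 * C).
  apply/is_derive_smallP => e e0; exists 1 => // t _; rewrite E1.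
  rewrite (_ : _ - _ - _ = 0); last by ring.
  by rewrite normr0 mulr_ge0// ltW.
have E2 : derive1n 2 phi = fun=> 2 * C.
  by apply/funext => y; rewrite /= derive1E; have [_ ->] := d2 y.
split.
- split=> [y|y|]; [by case: (d1 y)|by case: (d2 y)|].
  by rewrite E2 => y; exact: cst_continuous.
- by rewrite E1 subrr mulr0 addr0.
- by rewrite E2.
Qed.

Lemma visc_super_jet a H lam u : visc_super a H lam u -> jet_super a H lam u.
Proof.
move=> [_ hu] z p C [d d0 hd].
have [c2 d1 d2] := quadratic_C2 (u z) p C z.
have := hu _ z c2; rewrite d1 d2; apply; split.
  by rewrite subrr expr2 !mulr0 !addr0.
by exists d.
Qed.

Lemma visc_sub_jet a H lam u : visc_sub a H lam u -> jet_sub a H lam u.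
Proof.
move=> [_ hu] z p C [d d0 hd].
have [c2 d1 d2] := quadratic_C2 (u z) p C z.
have := hu _ z c2; rewrite d1 d2; apply; split.
  by rewrite subrr expr2 !mulr0 !addr0.
by exists d.
Qed.

End ViscosityJets.

(** * Interior regularity where the diffusion is positive *)

Section Elliptic.
Variables (R : realType) (alpha0 alpha1 gamma eta : R) (H : R -> R -> R).
Hypotheses (alpha0_gt0 : 0 < alpha0) (gamma_gt2 : 2 < gamma)
  (HH : H_sqc alpha0 alpha1 gamma eta H).
Implicit Types (a u : R -> R) (z p C : R).

(** The jet bounds first make [u] continuously differentiable near [z]. Every jet at [t] then has
    slope [derive1 u t], so the two viscosity inequalities pin [2 * C] against the continuous
    function [G]. *)
Lemma elliptic_regularity a lam u z : continuous a -> continuous u ->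
  jet_super a H lam u -> jet_sub a H lam u -> 0 < a z ->
  [/\ is_derive z 1 u (derive1 u z), {for z, continuous (derive1 u)} &
      is_derive z 1 (derive1 u) ((lam - H z (derive1 u z)) / a z)].
Proof.
move=> ca cu su sb az.
have az2 : 0 < a z / 2 by lra.
have /continuous_atP/(_ _ az2)[r r0 hr] := ca z.
have {}hr t : z - r < t < z + r -> a z / 2 < a t.
  by move=> ht; have := hr t; rewrite !ltr_norml => /(_ ltac:(lra)); lra.
(* A lower jet satisfies [a x * (2 * C) <= lam + 1 / alpha0] by the lower bound on [H], and
   [a x > a z / 2] nearby. *)
pose K := 2 * `|lam + alpha0^-1| / a z.
have KE : K * a z = 2 * `|lam + alpha0^-1| by rewrite /K divfK// gt_eqF.
have K0 : 0 <= K by rewrite divr_ge0 ?mulr_ge0// ltW.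
have reg t : z - r < t < z + r ->
    is_derive t 1 u (derive1 u t) /\ {for t, continuous (derive1 u)}.
  apply: (@derive1_of_jets _ u (z - r) (z + r) K) => [x _|x p C hx|x p hx].
  - exact: cu.
  - move=> /su h; have := H_ge alpha0_gt0 HH x p; have := hr x hx.
    have := ler_norm (lam + alpha0^-1); rewrite leNgt => h1 h2 h3.
    apply/negP => KC.
    have : a z / 2 * K <= a x * K by nra.
    have : a x * K < a x * (2 * C) by rewrite ltr_pM2l; lra.
    by lra.
  - exists ((lam - H x p) / a x / 2) => C /sb h.
    have ax := hr x hx.
    by rewrite ler_pdivrMr// ler_pdivrMr; lra.
have hz : z - r < z < z + r by rewrite ltrBlDr !ltrDl r0.
have [duz cfz] := reg z hz; split; [exact: duz|exact: cfz|].
apply: (second_derivative_of_jets r0) => [t ht|e e0]; first by exact: (reg t ht).1.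
pose G t := (lam - H t (derive1 u t)) / a t.
have cG : {for z, continuous G}.
  apply: continuousM; first apply: continuousB; first exact: cst_continuous.
    exact: (H_continuous_along gamma_gt2 HH cfz).
  by apply: continuousV; [rewrite gt_eqF|exact: ca].
have /continuous_atP/(_ _ e0)[d d0 hd] := cG.
have [s [s0 sr sd]] := exists_smaller r0 d0.
exists s => // t p C tz.
have := hd t (lt_trans tz sd).
move: tz; rewrite ltr_norml => tz.
have [dut _] := reg t ltac:(lra).
have at0 : 0 < a t by have := hr t ltac:(lra); lra.
rewrite ltr_norml {2 4}/G => hG; split=> j.
  have pE := lower_jet_is_derive dut j.
  have : 2 * C <= G t; last by lra.
  by have := su _ _ _ j; rewrite pE /G ler_pdivlMr//; lra.
have pE := upper_jet_is_derive dut j.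
have : G t <= 2 * C; last by lra.
by have := sb _ _ _ j; rewrite pE /G ler_pdivrMr//; lra.
Qed.

End Elliptic.

(** * Degenerate points *)

Section NearbyJets.
Variable R : realType.
Implicit Types (u : R -> R) (s z p C D e : R).

(** Nothing bounds [C] itself from below; the controlled quantity [C * (z - s) ^ 2] is the one that
    matters when [a] vanishes quadratically at [s]. *)
Lemma lower_jet_near u s e : continuous u -> 0 < e ->
  exists z p C, [/\ `|z - s| < e, - e <= C * (z - s) ^+ 2, C <= 0 & lower_jet u z p C].
Proof.
move=> cu e0; have w0 : 0 < e / 3 by lra.
have /continuous_atP/(_ _ w0)[d d0 hd] := cu s.
have [r [r0 rd re]] := exists_smaller d0 e0.
have [||t _|t tr|z zs j] := @lower_jet_of_oscillation R u s 0 r (e / 3) => //.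
- exact: cu.
- by rewrite mul0r subr0 ltW// hd//; lra.
exists z, (0 - 2 * (3 * (e / 3) / r ^+ 2) * (z - s)), (- (3 * (e / 3) / r ^+ 2)).
have B0 : 0 < 3 * (e / 3) / r ^+ 2 by rewrite divr_gt0 ?exprn_gt0//; lra.
have BE : 3 * (e / 3) / r ^+ 2 * r ^+ 2 = e.
  by rewrite divfK ?expf_eq0/= ?gt_eqF//; lra.
split=> //; [by lra| |by lra].
have : (z - s) ^+ 2 <= r ^+ 2.
  by rewrite -[leLHS]real_normK ?num_real// ler_pXn2r ?nnegrE//; lra.
by rewrite -(ler_pM2l B0) BE; lra.
Qed.

Lemma lower_jet_near_derive u s D e : continuous u -> is_derive s 1 u D -> 0 < e ->
  exists z p C, [/\ `|z - s| < e, `|p - D| < e, - e <= C * (z - s) ^+ 2, C <= 0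
    & lower_jet u z p C].
Proof.
move=> cu /is_derive_smallP du e0; have w0 : 0 < e / 7 by lra.
have [d d0 hd] := du _ w0.
have [r [r0 rd re]] := exists_smaller d0 e0.
have [q [q0 qr q1]] := exists_smaller r0 ltr01.
(* The penalty coefficient [B = 3 * w / q ^ 2] then satisfies [B * q = 3 * e / 7], so the slope
   error [2 * B * |z - s|] is at most [6 * e / 7]; [q < 1] controls [B * q ^ 2]. *)
pose w := e / 7 * q; have w1 : 0 < w by rewrite mulr_gt0.
have [||t _|t tr|z zs j] := @lower_jet_of_oscillation R u s D q w => //.
- exact: cu.
- apply: le_trans (hd t _) _; first by lra.
  by rewrite /w ler_pM2l.
exists z, (D - 2 * (3 * w / q ^+ 2) * (z - s)), (- (3 * w / q ^+ 2)).
have BE : 3 * w / q ^+ 2 * q = 3 * e / 7.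
  by rewrite /w; field; rewrite gt_eqF.
have B0 : 0 < 3 * w / q ^+ 2 by rewrite divr_gt0 ?exprn_gt0//; lra.
move: BE B0 j; set B := 3 * w / q ^+ 2 => BE B0 j.
have zq : `|z - s| ^+ 2 <= q ^+ 2 by rewrite ler_pXn2r ?nnegrE//; lra.
rewrite real_normK ?num_real// in zq.
split=> //; [by lra| | |by lra].
  rewrite addrAC subrr add0r normrN normrM gtr0_norm; last by lra.
  have : B * `|z - s| <= B * q by rewrite ler_pM2l; lra.
  by lra.
have : B * (z - s) ^+ 2 <= B * q ^+ 2 by rewrite ler_pM2l.
have -> : B * q ^+ 2 = 3 * e / 7 * q by rewrite -BE; ring.
by nra.
Qed.

Lemma derive_le_slope u s D (m d : R) : is_derive s 1 u D -> 0 < d ->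
  (forall w, s < w < s + d -> u w - u s <= m * (w - s)) -> D <= m.
Proof.
move=> /is_derive_smallP du d0 hm; apply/ler_addgt0Pr => e e0.
have [r r0 hr] := du e e0; have [q [q0 qr qd]] := exists_smaller r0 d0.
have := hr (s + q); have := hm (s + q) ltac:(lra).
rewrite (_ : s + q - s = q); last by ring.
rewrite gtr0_norm// ler_norml => h1 /(_ qr) h2.
by rewrite -(ler_pM2r q0); lra.
Qed.

End NearbyJets.

(** * First-order inequalities and slope thresholds at zeros of the diffusion *)

Section DegeneratePoints.
Variables (R : realType) (alpha0 alpha1 gamma eta : R) (H : R -> R -> R).
Hypotheses (alpha0_gt0 : 0 < alpha0) (gamma_gt2 : 2 < gamma) (eta_gt0 : 0 < eta)
  (HH : H_sqc alpha0 alpha1 gamma eta H).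
Variables (a : R -> R) (K : R).
Hypotheses (a_cont : continuous a) (a_ge0 : forall x, 0 <= a x) (K_gt0 : 0 < K)
  (a_quad : forall l t, a l = 0 -> a t <= K * (t - l) ^+ 2).
Implicit Types (u v : R -> R) (s t x y z l p q c d e C D P lam mu : R).

Lemma jet_diffusion_ge s z C e : a s = 0 -> - e <= C * (z - s) ^+ 2 -> C <= 0 ->
  - (2 * K * e) <= a z * (2 * C).
Proof.
move=> as0 hC C0; have := a_quad z as0; have := a_ge0 z; have := K_gt0 => K0.
move: hC; set X := (z - s) ^+ 2 => hC A0 AK.
have : K * X * C <= a z * C by rewrite ler_wnM2r.
have : K * - e <= K * (C * X) by rewrite ler_pM2l.
lra.
Qed.

(** Lower jets near [z] have an almost negligible diffusion term, and coercivity bounds their slopes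
    [p]. Then [H z P <= H z p], and [H z p] is close to [H z' p], which is at most [lam] up to a
    small error. *)
Lemma super_min_le lam v z P : continuous v -> jet_super a H lam v -> a z = 0 ->
  (forall p, H z P <= H z p) -> H z P <= lam.
Proof.
move=> cv sv az minP; apply/ler_addgt0Pr => e e0.
have [M hM] := H_coercive alpha0_gt0 gamma_gt2 HH (lam + 1).
have [L L0 hL] := H_lipschitz_space gamma_gt2 HH M.
have K0 := K_gt0.
have e1 : 0 < e / 2 / L by rewrite divr_gt0//; lra.
have e2 : 0 < e / 2 / (2 * K) by rewrite divr_gt0//; lra.
(* This keeps the diffusion term above [- 1], so [H z' p <= lam + 1] and the coercivity bound [M]
   applies. *)
have e3 : 0 < 1 / (2 * K) by rewrite divr_gt0//; lra.
have [r1 [r10 r1L r1K]] := exists_smaller e1 e2.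
have [r [r0 rr rK]] := exists_smaller r10 e3.
have [z' [p [C [zz hC C0 j]]]] := lower_jet_near z cv r0.
have h1 := sv _ _ _ j; have h2 := jet_diffusion_ge az hC C0.
rewrite ltr_pdivlMr// in r1L; rewrite ltr_pdivlMr in r1K; last by lra.
rewrite ltr_pdivlMr in rK; last by lra.
have pM : `|p| <= M by apply: (hM z'); lra.
have h3 := hL z z' p pM; have h4 := minP p.
have : L * `|z - z'| < e / 2 by rewrite distrC; nra.
have : 2 * K * r < e / 2 by nra.
by move: h3; rewrite ler_norml; lra.
Qed.

(** The equation becomes first order at a zero of [a]: along nearby jets the slopes tend to [D] and
    the diffusion terms are bounded below by quantities tending to zero. *)
Lemma super_derive_le lam v s D : continuous v -> jet_super a H lam v -> a s = 0 ->
  is_derive s 1 v D -> H s D <= lam.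
Proof.
move=> cv sv az dv; apply/ler_addgt0Pr => e e0.
have [L L0 hL] := H_lipschitz_space gamma_gt2 HH (`|D| + 1).
have [L' L'0 hL'] := H_lipschitz_momentum gamma_gt2 HH (`|D| + 1).
have K0 := K_gt0.
have S0 : 0 < 2 * K + L + L' by lra.
have e1 : 0 < e / (2 * K + L + L') by rewrite divr_gt0.
have [r [r0 rL r1]] := exists_smaller e1 ltr01.
rewrite ltr_pdivlMr// in rL.
have [z [p [C [zs pD hC C0 j]]]] := lower_jet_near_derive cv dv r0.
have h1 := sv _ _ _ j; have h2 := jet_diffusion_ge az hC C0.
have pM : `|p| <= `|D| + 1.
  have -> : p = D + (p - D) by ring.
  by apply: le_trans (ler_normD _ _) _; lra.
have DM : `|D| <= `|D| + 1 by lra.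
have h3 := hL' s D p DM pM; have h4 := hL s z p pM.
rewrite distrC in zs; rewrite distrC in pD.
have g1 : L' * `|D - p| <= L' * r by rewrite ler_pM2l// ltW.
have g2 : L * `|s - z| <= L * r by rewrite ler_pM2l// ltW.
by move: h3 h4; rewrite !ler_norml; lra.
Qed.

Lemma sub_derive_ge lam u s D : continuous u -> jet_sub a H lam u -> a s = 0 ->
  is_derive s 1 u D -> lam <= H s D.
Proof.
move=> cv sv az dv; apply/ler_addgt0Pr => e e0.
have [L L0 hL] := H_lipschitz_space gamma_gt2 HH (`|D| + 1).
have [L' L'0 hL'] := H_lipschitz_momentum gamma_gt2 HH (`|D| + 1).
have K0 := K_gt0.
have S0 : 0 < 2 * K + L + L' by lra.
have e1 : 0 < e / (2 * K + L + L') by rewrite divr_gt0.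
have [r [r0 rL r1]] := exists_smaller e1 ltr01.
rewrite ltr_pdivlMr// in rL.
have cNu : continuous (- u) by move=> x; apply: continuousN; exact: cv.
have [z [p [C [zs pD hC C0 j]]]] := lower_jet_near_derive cNu (is_deriveN dv) r0.
have /lower_jetN/sv h1 := j; have h2 := jet_diffusion_ge az hC C0.
have {}pD : `|- p - D| < r by move: pD; rewrite opprK -normrN opprD.
move: h1 pD; set p' := - p => h1 pD.
have pM : `|p'| <= `|D| + 1.
  have -> : p' = D + (p' - D) by ring.
  by apply: le_trans (ler_normD _ _) _; lra.
have DM : `|D| <= `|D| + 1 by lra.
have h3 := hL' s D p' DM pM; have h4 := hL s z p' pM.
rewrite distrC in zs; rewrite distrC in pD.
have g1 : L' * `|D - p'| <= L' * r by rewrite ler_pM2l// ltW.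
have g2 : L * `|s - z| <= L * r by rewrite ler_pM2l// ltW.
by move: h3 h4; rewrite !ler_norml; lra.
Qed.

Lemma H_level_right x P c : H x P < c -> exists2 q, P < q & H x q = c.
Proof.
move=> Pc; have [M hM] := H_coercive alpha0_gt0 gamma_gt2 HH c.
pose Q := `|P| + `|M| + 1; have PQ : P < Q.
  by have := ler_norm P; have := normr_ge0 M; rewrite /Q; lra.
have cQ : c < H x Q.
  rewrite ltNge; apply/negP => /hM; have := ler_norm M; have := ler_norm Q.
  by have := normr_ge0 P; rewrite {1}/Q; lra.
have cH : {within `[P, Q], continuous (H x)}.
  by apply: pointwise_within => t _; exact: (H_momentum_continuous gamma_gt2 HH).
have [|q] := @IVT R (H x) P Q c (ltW PQ) cH.
  by rewrite ge_min le_max (ltW Pc) (ltW cQ) orbT.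
rewrite in_itv /= => /andP[Pq qQ] Hq; exists q => //.
by rewrite lt_neqAle Pq andbT; apply: contraTneq Pc => ->; rewrite Hq ltxx.
Qed.

Lemma H_level_left x P c : H x P < c -> exists2 q, q < P & H x q = c.
Proof.
move=> Pc; have [M hM] := H_coercive alpha0_gt0 gamma_gt2 HH c.
pose Q := - (`|P| + `|M| + 1); have PQ : Q < P.
  by have := ler_norm (- P); rewrite normrN; have := normr_ge0 M; rewrite /Q; lra.
have cQ : c < H x Q.
  rewrite ltNge; apply/negP => /hM; have := ler_norm M; have := ler_norm (- Q).
  by rewrite normrN; have := normr_ge0 P; rewrite {1}/Q; lra.
have cH : {within `[Q, P], continuous (H x)}.
  by apply: pointwise_within => t _; exact: (H_momentum_continuous gamma_gt2 HH).
have [|q] := @IVT R (H x) Q P c (ltW PQ) cH.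
  by rewrite ge_min le_max (ltW Pc) (ltW cQ) !orbT.
rewrite in_itv /= => /andP[Qq qP] Hq; exists q => //.
by rewrite lt_neqAle qP andbT; apply: contraTneq Pc => <-; rewrite Hq ltxx.
Qed.

(** Read through [a f' = level - H]: below [q0] a derivative at level [mu] decreases at rate at
    least [c / a]; between [q0] and [q1] a derivative at level [lam] increases at that rate, and
    above [q2] it decreases. *)
Definition barriers lam mu z q0 q1 q2 c d := forall x, z <= x < z + d ->
  [/\ forall p, p <= q0 -> mu + c <= H x p,
      forall p, q0 <= p <= q1 -> H x p <= lam - c,
      forall p, q2 <= p -> lam + c <= H x p &
      forall p p', q1 <= p -> p < p' -> eta * (p' - p) <= H x p' - H x p].

(** Quasiconvexity extends finitely many comparisons to all slopes. Since [H x] grows from [P] to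
    [q1], its minimiser is at most [q1], whence the rate [eta] beyond [q1]. *)
Lemma barriers_at x P q0 q1 q2 c lam mu : q0 < P -> P < q1 -> q1 < q2 ->
  H x P < H x q0 -> H x P < H x q1 -> H x q1 < H x q2 ->
  mu + c <= H x q0 <= lam - c -> H x q1 <= lam - c -> lam + c <= H x q2 ->
  [/\ forall p, p <= q0 -> mu + c <= H x p,
      forall p, q0 <= p <= q1 -> H x p <= lam - c,
      forall p, q2 <= p -> lam + c <= H x p &
      forall p p', q1 <= p -> p < p' -> eta * (p' - p) <= H x p' - H x p].
Proof.
move=> q0P Pq1 q12 h0 h1 h2 /andP[l0 r0] r1 l2; split.
- by move=> p /(H_decreasing_left HH q0P h0); exact: le_trans.
- by move=> p hp; exact: (H_le_between HH hp).
- by move=> p /(H_increasing_right HH q12 h2); exact: le_trans.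
have [_ _ _ _ [phat hp]] := HH; have [_ _ lo up] := hp x.
have xq1 : phat x <= q1.
  rewrite leNgt; apply/negP => q1x; have := lo P q1 Pq1 (ltW q1x).
  rewrite leNgt => /negP; apply; apply: (@lt_le_trans _ _ 0).
    by rewrite subr_lt0.
  by rewrite mulr_ge0// ltW.
move=> p p' q1p pp'; have := up p p' pp' (le_trans xq1 q1p).
by rewrite distrC gtr0_norm// subr_gt0.
Qed.

(** Here [pp] is the larger root of [H z = lam], which exists because [v] forces the minimum of
    [H z] to be at most [mu]. It is fixed before [e], so [q1] and [q2] can squeeze it. *)
Lemma barriers_exist lam mu v z : mu < lam -> continuous v -> jet_super a H mu v ->
  a z = 0 -> exists pp, forall e, 0 < e -> exists q0 q1 q2 c d,
    [/\ [/\ 0 < c, 0 < d & q0 <= q1], pp - e < q1, q2 < pp + e &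
        barriers lam mu z q0 q1 q2 c d].
Proof.
move=> mulam cv sv az; have [_ _ _ _ [phat hp]] := HH.
pose P := phat z; have := hp z; rewrite -/P => -[minP _ _ upP] {hp}.
have Pmu : H z P <= mu by apply: (super_min_le cv sv az).
have [pp Ppp Hpp] := @H_level_right z P lam ltac:(lra).
(* The middle level leaves room both above [mu] and below [lam]. *)
have [q0 q0P Hq0] := @H_level_left z P ((mu + lam) / 2) ltac:(lra).
exists pp => e e0.
have ppP : 0 < pp - P by lra.
have [e1 [e10 e1e e1P]] := exists_smaller e0 ppP.
have et0 := eta_gt0.
pose q1 := pp - e1; pose q2 := pp + e1.
have Hq1 : H z q1 <= lam - eta * e1.
  have := upP q1 pp ltac:(rewrite /q1; lra) ltac:(rewrite /q1; lra).
  by rewrite ltr0_norm /q1; lra.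
have Hq2 : lam + eta * e1 <= H z q2.
  have := upP pp q2 ltac:(rewrite /q2; lra) ltac:(lra).
  by rewrite ltr0_norm /q2; lra.
have Hq1P : H z P + eta * (q1 - P) <= H z q1.
  have := upP P q1 ltac:(rewrite /q1; lra) (lexx _).
  by rewrite ltr0_norm /q1; lra.
have m1 : 0 < eta * e1 / 4 by rewrite divr_gt0// mulr_gt0.
have m2 : 0 < eta * (q1 - P) / 4 by rewrite divr_gt0// mulr_gt0// /q1; lra.
have m3 : 0 < (lam - mu) / 8 by lra.
have [c1 [c10 c1m1 c1m2]] := exists_smaller m1 m2.
have [c [c0 cc1 cm3]] := exists_smaller c10 m3.
have [Pq1 q12] : P < q1 /\ q1 < q2 by rewrite /q1 /q2; lra.
have [q1e q2e] : pp - e < q1 /\ q2 < pp + e by rewrite /q1 /q2; lra.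
have g1 : 4 * c < eta * e1 by lra.
have g2 : 4 * c < eta * (q1 - P) by lra.
have g3 : 8 * c < lam - mu by lra.
clear m1 m2 m3 c10 cc1 cm3 c1m1 c1m2.
(* One space-Lipschitz constant serves all four slopes; moving [x] by less than [c / L] changes each
   value of [H] by at most [c]. *)
pose M := `|q0| + `|P| + `|q1| + `|q2|.
have [L L0 hL] := H_lipschitz_space gamma_gt2 HH M.
exists q0, q1, q2, c, (c / L); split=> //.
- by split=> //; [rewrite divr_gt0|exact/ltW/(lt_trans q0P)].
move=> x /andP[zx xd].
have xc : L * `|x - z| <= c.
  by rewrite ger0_norm ?subr_ge0// mulrC -ler_pdivlMr// lerBlDl ltW.
have close p : `|p| <= M -> H z p - c <= H x p <= H z p + c.
  by move=> /(hL x z)/le_trans/(_ xc); rewrite ler_distl.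
have xq0 : H z q0 - c <= H x q0 <= H z q0 + c.
  by apply: close; rewrite /M -!addrA lerDl !addr_ge0.
have xP : H z P - c <= H x P <= H z P + c.
  by apply: close; rewrite /M [`|q0| + _]addrC -!addrA lerDl !addr_ge0.
have xq1 : H z q1 - c <= H x q1 <= H z q1 + c.
  by apply: close; rewrite /M addrAC lerDr !addr_ge0.
have xq2 : H z q2 - c <= H x q2 <= H z q2 + c by apply: close; rewrite /M lerDr !addr_ge0.
clear close xc hL zx xd upP minP.
by apply: (@barriers_at x P) => //; lra.
Qed.

End DegeneratePoints.

(** * Uniqueness *)

Section Uniqueness.
Variables (R : realType) (alpha0 alpha1 gamma eta : R) (H : R -> R -> R).
Hypotheses (alpha0_gt0 : 0 < alpha0) (gamma_gt2 : 2 < gamma) (eta_gt0 : 0 < eta)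
  (HH : H_sqc alpha0 alpha1 gamma eta H).
Variables (a : R -> R) (K : R).
Hypotheses (a_cont : continuous a) (a_ge0 : forall x, 0 <= a x) (K_gt0 : 0 < K)
  (a_quad : forall l t, a l = 0 -> a t <= K * (t - l) ^+ 2).
Variables (lam mu : R).
Hypothesis mu_lt_lam : mu < lam.
Implicit Types (u v : R -> R) (s t x y z l p q c d e C D : R).

Definition jet_sol lam u :=
  [/\ continuous u, jet_super a H lam u & jet_sub a H lam u].

(** This is all that is retained from the almost-everywhere ordering of derivatives. *)
Definition densely_ge u v := forall x y, x < y -> exists s Du Dv,
  [/\ x < s < y, is_derive s 1 u Du, is_derive s 1 v Dv & Dv <= Du].

Definition dominating u := jet_sol lam u /\
  exists v, jet_sol mu v /\ densely_ge u v.

Lemma jet_sol_regular nu u z : jet_sol nu u -> 0 < a z ->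
  [/\ is_derive z 1 u (derive1 u z), {for z, continuous (derive1 u)} &
      is_derive z 1 (derive1 u) ((nu - H z (derive1 u z)) / a z)].
Proof. by move=> [cu su sb]; exact: (elliptic_regularity alpha0_gt0 gamma_gt2 HH). Qed.

Lemma last_zero z t : z < t -> a z = 0 -> 0 < a t ->
  exists l, [/\ z <= l < t, a l = 0 & forall x, l < x <= t -> 0 < a x].
Proof.
move=> zt az at0.
have [||l [hl al hpos]] := @last_nonpositive R a z t (fun x _ => @a_cont x) (ltW zt) => //.
  by rewrite az.
by exists l; split=> //; apply/eqP; rewrite eq_le al a_ge0.
Qed.

(** Converts a rate divided by [a] into the inverse-square rate required by the singular
    differential inequalities. *)
Lemma singular_rate l t c X : a l = 0 -> 0 < a t -> l < t -> 0 <= c -> c <= X ->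
  c / K / (t - l) ^+ 2 <= X / a t.
Proof.
move=> al at0 lt c0 cX; have tl : 0 < (t - l) ^+ 2 by rewrite exprn_gt0//; lra.
rewrite -mulrA -invfM; apply: ler_pM => //.
  by rewrite invr_ge0 mulr_ge0// ltW.
by rewrite lef_pV2 ?posrE//; [exact: a_quad|exact: mulr_gt0].
Qed.

(** Both derivatives are continuous where [a > 0], so a strict reversal would hold on a whole
    interval, against density. *)
Lemma derive1_ge u v t : jet_sol lam u -> jet_sol mu v -> densely_ge u v ->
  0 < a t -> derive1 v t <= derive1 u t.
Proof.
move=> su sv uv at0; rewrite leNgt; apply/negP => lt_uv.
have [_ cu _] := jet_sol_regular su at0; have [_ cv _] := jet_sol_regular sv at0.
have cg : {for t, continuous (fun x => derive1 v x - derive1 u x)}.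
  by apply: continuousB.
have g0 : 0 < derive1 v t - derive1 u t by lra.
have /continuous_atP/(_ _ g0)[d d0 hd] := cg.
have /continuous_atP/(_ _ at0)[r r0 hr] := @a_cont t.
have [q [q0 qd qr]] := exists_smaller d0 r0.
have [s [Du [Dv [hs du dv DD]]]] := uv t (t + q) ltac:(lra).
have sq : `|s - t| < q by rewrite ltr_norml; lra.
have := hr s (lt_trans sq qr); rewrite ltr_norml => has.
have as0 : 0 < a s by lra.
have [du' _ _] := jet_sol_regular su as0; have [dv' _ _] := jet_sol_regular sv as0.
have := hd s (lt_trans sq qd).
rewrite (is_derive_unique du' du) (is_derive_unique dv' dv) ltr_norml.
lra.
Qed.

(** The singularity is placed at [l], the last zero of [a] before [t], which may differ from [z]
    when components accumulate. The lower bound uses [derive1 v] as the barrier; above [q2] the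
    derivative would blow up like [1 / (t - l)], against continuity of [u] at [l]. *)
Lemma derive1_between u v z q0 q1 q2 c d t : jet_sol lam u -> jet_sol mu v ->
  densely_ge u v -> a z = 0 -> 0 < c -> q0 <= q1 ->
  barriers eta H lam mu z q0 q1 q2 c d -> z < t < z + d -> 0 < a t ->
  q1 < derive1 u t < q2.
Proof.
move=> su sv uv az c0 q01 bar ht at0.
have [l [hl al pos]] := last_zero (z := z) (t := t) ltac:(lra) az at0.
have lt : l < t by lra.
have cK : 0 < c / K by rewrite divr_gt0.
have bar' x : l < x <= t -> z <= x < z + d by lra.
have du x : l < x <= t -> is_derive x 1 u (derive1 u x).
  by move=> /pos/(jet_sol_regular su)[].
have ddu x : l < x <= t ->
    is_derive x 1 (derive1 u) ((lam - H x (derive1 u x)) / a x).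
  by move=> /pos/(jet_sol_regular su)[].
have ddv x : l < x <= t ->
    is_derive x 1 (derive1 v) ((mu - H x (derive1 v x)) / a x).
  by move=> /pos/(jet_sol_regular sv)[].
apply/andP; split.
  apply: (lower_barrier lt cK ddu ddv _ _ _ q01) => x hx.
  - by apply: derive1_ge su sv uv (pos x hx).
  - have [b0 _ _ _] := bar x (bar' x hx); move=> /b0 hb.
    rewrite -[leLHS]opprK lerN2 -mulNr; apply: singular_rate => //; [exact: pos|lra..].
  - have [_ b1 _ _] := bar x (bar' x hx); move=> /b1 hb.
    by apply: singular_rate => //; [exact: pos|lra..].
rewrite ltNge; apply/negP => q2t.
have [cu _ _] := su.
apply: (@derivative_not_hyperbolic R u (derive1 u) l t (c / K) q2 lt cK (cu l) du).
apply: (blowup_left lt cK ddu _ q2t) => x hx.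
have [_ _ b2 _] := bar x (bar' x hx); move=> /b2 hb.
rewrite -[leLHS]opprK lerN2 -mulNr; apply: singular_rate => //; [exact: pos|lra..].
Qed.

(** A violation yields a lower jet of slope above [q2]. Where [a > 0] this contradicts the bound on
    the derivative; where [a = 0], the supersolution inequality contradicts [H >= lam + c]. *)
Lemma increment_le u v z q0 q1 q2 c d x y : jet_sol lam u -> jet_sol mu v ->
  densely_ge u v -> a z = 0 -> 0 < c -> q0 <= q1 ->
  barriers eta H lam mu z q0 q1 q2 c d -> z <= x -> x < y -> y < z + d ->
  u y - u x <= q2 * (y - x).
Proof.
move=> su sv uv az c0 q01 bar zx xy yz; rewrite leNgt; apply/negP => hm.
have [cu sup _] := su.
have [s [p [C [hs q2p j]]]] := lower_jet_mean_value xy (fun t _ => cu t) hm.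
have [as0|as0] := leP (a s) 0; last first.
  have [du _ _] := jet_sol_regular su as0.
  have := derive1_between su sv uv az c0 q01 bar (t := s) ltac:(lra) as0.
  by rewrite -(lower_jet_is_derive du j); lra.
have as0' : a s = 0 by apply/eqP; rewrite eq_le as0 a_ge0.
have := sup _ _ _ j; rewrite as0' mul0r add0r.
have [_ _ b2 _] := bar s ltac:(lra).
by have := b2 p (ltW q2p); lra.
Qed.

(* A function without interior local maxima decreases up to its minimum, so a
   failure of the estimate would produce an interval on which the derivative of
   [u], where it exists, is at most [q1]. *)
Lemma increment_ge u v z q0 q1 q2 c d x y : jet_sol lam u -> jet_sol mu v ->
  densely_ge u v -> a z = 0 -> 0 < c -> q0 <= q1 ->
  barriers eta H lam mu z q0 q1 q2 c d -> z <= x -> x < y -> y < z + d ->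
  q1 * (y - x) <= u y - u x.
Proof.
move=> su sv uv az c0 q01 bar zx xy yz; rewrite leNgt; apply/negP => hm.
have [cu _ sub] := su; have [cv svp _] := sv.
pose g t := u t - q1 * t.
have cg t : {for t, continuous g}.
  apply: continuousB; first exact: cu.
  by apply: continuousM => //; exact: cst_continuous.
(* An interior maximum of [g] is an upper jet of [u] with slope [q1] and [C = 0], impossible both
   where [a > 0] and, by the subsolution inequality, where [a = 0]. *)
have no_max s t m : x <= s -> s < t -> t < m -> m <= y ->
    g s < g t -> g m < g t -> False.
  move=> xs st tm my gst gmt.
  have sm : s <= m by lra.
  have cNg r : {for r, continuous (- g)} by apply: continuousN; exact: cg.
  have [r hr rm] := EVT_min_pointwise sm (fun r _ => cNg r).
  have {}rm k : s <= k <= m -> g k <= g r by move=> /rm; rewrite !fctE lerN2.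
  have grt := rm t ltac:(lra).
  have sr : s < r.
    rewrite lt_neqAle; case/andP: hr => -> _; rewrite andbT.
    by apply/eqP => E; move: grt; rewrite -E leNgt gst.
  have rm' : r < m.
    rewrite lt_neqAle; case/andP: hr => _ ->; rewrite andbT.
    by apply/eqP => E; move: grt; rewrite E leNgt gmt.
  have j : upper_jet u r q1 0.
    have d1 : 0 < r - s by lra.
    have d2 : 0 < m - r by lra.
    have [k [k0 k1 k2]] := exists_smaller d1 d2.
    exists k => // w; rewrite ltr_norml => hw.
    by have := rm w ltac:(lra); rewrite /g; lra.
  have [ar|ar] := leP (a r) 0; last first.
    have [du _ _] := jet_sol_regular su ar.
    have := derive1_between su sv uv az c0 q01 bar (t := r) ltac:(lra) ar.
    by rewrite -(upper_jet_is_derive du j); lra.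
  have ar' : a r = 0 by apply/eqP; rewrite eq_le ar a_ge0.
  have := sub _ _ _ j; rewrite ar' mul0r add0r.
  have [_ b1 _ _] := bar r ltac:(lra).
  by have := b1 q1 ltac:(lra); lra.
have [m hmi mm] := EVT_min_pointwise (ltW xy) (fun r _ => cg r).
have xm : x < m.
  rewrite lt_neqAle; case/andP: hmi => -> _; rewrite andbT; apply/eqP => E.
  by have := mm y ltac:(lra); rewrite -E /g; lra.
have dec s t : x <= s -> s < t -> t < m -> g t <= g s.
  move=> xs st tm; rewrite leNgt; apply/negP => gst.
  apply: (no_max s t m) => //; first by lra.
  by apply: le_lt_trans gst; apply: mm; lra.
have [s [Du [Dv [hs du dv DD]]]] := uv x m xm.
have Duq : Du <= q1.
  have ms : 0 < m - s by lra.
  apply: (derive_le_slope du ms) => w hw.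
  by have := dec s w ltac:(lra) ltac:(lra) ltac:(lra); rewrite /g; lra.
have [as0|as0] := leP (a s) 0; last first.
  have [du' _ _] := jet_sol_regular su as0.
  have := derive1_between su sv uv az c0 q01 bar (t := s) ltac:(lra) as0.
  by rewrite (is_derive_unique du' du); lra.
have as0' : a s = 0 by apply/eqP; rewrite eq_le as0 a_ge0.
(* At a zero of [a], [H s Dv <= mu] excludes [Dv <= q0]. The ordering then gives
   [q0 < Dv <= Du <= q1], where [H < lam], against [H s Du >= lam]. *)
have h1 := super_derive_le gamma_gt2 HH a_ge0 K_gt0 a_quad cv svp as0' dv.
have h2 := sub_derive_ge gamma_gt2 HH a_ge0 K_gt0 a_quad cu sub as0' du.
have [b0 b1 _ _] := bar s ltac:(lra).
have [Dvq|Dvq] := leP Dv q0; first by have := b0 Dv Dvq; lra.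
by have := b1 Du ltac:(lra); lra.
Qed.

(** The same thresholds trap the right difference quotients of both solutions between [q1] and [q2],
    which are less than [e] apart. *)
Lemma right_derivative_difference u1 u2 z e : dominating u1 -> dominating u2 ->
  a z = 0 -> 0 < e -> exists2 d, 0 < d & forall y, z < y < z + d ->
    u1 y - u2 y - (u1 z - u2 z) <= e * (y - z).
Proof.
move=> [su1 [v1 [sv1 uv1]]] [su2 [v2 [sv2 uv2]]] az e0.
have [cv1 svp1 _] := sv1.
have [pp hpp] := barriers_exist alpha0_gt0 gamma_gt2 eta_gt0 HH a_ge0 K_gt0 a_quad
  mu_lt_lam cv1 svp1 az.
have e2 : 0 < e / 2 by lra.
have [q0 [q1 [q2 [c [d [[c0 d0 q01] h1 h2 bar]]]]]] := hpp _ e2.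
exists d => // y hy.
have := increment_le su1 sv1 uv1 az c0 q01 bar (lexx z) (y := y) ltac:(lra) ltac:(lra).
have := increment_ge su2 sv2 uv2 az c0 q01 bar (lexx z) (y := y) ltac:(lra) ltac:(lra).
have yz : 0 < y - z by lra.
move=> i1 i2; have : (q2 - q1) * (y - z) <= e * (y - z) by rewrite ler_pM2r//; lra.
lra.
Qed.

(* Near the left end of a component both derivatives lie in the range where [H] is
   increasing, so a gap between them would grow like [1 / (t - l)] towards the
   left, against the bound [q2 - q1]. *)
Lemma derive1_le_near_zero u1 u2 l t : dominating u1 -> dominating u2 -> a l = 0 ->
  l < t -> (forall x, l < x <= t -> 0 < a x) ->
  exists2 d, 0 < d & forall x, l < x < l + d -> x <= t -> derive1 u1 x <= derive1 u2 x.
Proof.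
move=> [su1 [v1 [sv1 uv1]]] [su2 [v2 [sv2 uv2]]] al lt pos.
have [cv1 svp1 _] := sv1.
have [pp hpp] := barriers_exist alpha0_gt0 gamma_gt2 eta_gt0 HH a_ge0 K_gt0 a_quad
  mu_lt_lam cv1 svp1 al.
have [q0 [q1 [q2 [c [d [[c0 d0 q01] _ _ bar]]]]]] := hpp _ ltr01.
exists d => // s hs st; rewrite leNgt; apply/negP => gap.
pose g x := derive1 u1 x - derive1 u2 x.
have gs : 0 < g s by rewrite /g; lra.
pose dg x := (lam - H x (derive1 u1 x)) / a x - (lam - H x (derive1 u2 x)) / a x.
have dgP x : l < x <= s -> is_derive x 1 g (dg x).
  move=> hx; have ax : 0 < a x by apply: pos; lra.
  have [_ _ d1] := jet_sol_regular su1 ax; have [_ _ d2] := jet_sol_regular su2 ax.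
  exact: is_deriveB.
have cK : 0 < eta * g s / K by rewrite divr_gt0// mulr_gt0.
have rate x : l < x <= s -> g s <= g x -> dg x <= - (eta * g s / K / (x - l) ^+ 2).
  move=> hx gx; have ax : 0 < a x by apply: pos; lra.
  have b1 := derive1_between su1 sv1 uv1 al c0 q01 bar (t := x) ltac:(lra) ax.
  have b2 := derive1_between su2 sv2 uv2 al c0 q01 bar (t := x) ltac:(lra) ax.
  have [_ _ _ mono] := bar x ltac:(lra).
  have := mono (derive1 u2 x) (derive1 u1 x) (ltW (andP b2).1).
  move: gx; rewrite {2}/g => gx /(_ ltac:(lra)) hm.
  have -> : dg x = - ((H x (derive1 u1 x) - H x (derive1 u2 x)) / a x).
    by rewrite /dg; field; rewrite gt_eqF.
  rewrite lerN2; apply: singular_rate => //; first by case/andP: hx.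
    by rewrite mulr_ge0// ltW.
  by apply: le_trans hm; rewrite ler_pM2l.
have ls : l < s by lra.
have q21 : q1 < q2.
  have as0 : 0 < a s by apply: pos; rewrite ls st.
  by have /andP[] := derive1_between su1 sv1 uv1 al c0 q01 bar hs as0; exact: lt_trans.
have r10 : 0 < (s - l) / 2 by lra.
(* Below this value of [r] the forced gap at [l + r] exceeds the width [q2 - q1] of the range
   containing both derivatives. *)
have r20 : 0 < eta * g s / K / (4 * (q2 - q1)) by rewrite divr_gt0//; lra.
have [r [r0 r1 r2]] := exists_smaller r10 r20.
have := blowup_left ls cK dgP rate (lexx _) r0 ltac:(lra).
have ar : 0 < a (l + r) by apply: pos; lra.
have := derive1_between su1 sv1 uv1 al c0 q01 bar (t := l + r) ltac:(lra) ar.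
have := derive1_between su2 sv2 uv2 al c0 q01 bar (t := l + r) ltac:(lra) ar.
have gE : g (l + r) = derive1 u1 (l + r) - derive1 u2 (l + r) by [].
move=> b2 b1 hb.
have : q2 - q1 < eta * g s / K / (4 * r).
  have q40 : 0 < 4 * (q2 - q1) by rewrite mulr_gt0// subr_gt0.
  rewrite ltr_pdivlMr// in r2; rewrite ltr_pdivlMr ?mulr_gt0//.
  by rewrite mulrCA (mulrC (q2 - q1)) mulrCA.
lra.
Qed.

(** Near [s] both functions are bounded by [M] and [a] exceeds [a s / 2], so the right-hand side of
    the equation is Lipschitz in the slope. *)
Lemma ode_difference_bound (f1 f2 : R -> R) s : {for s, continuous f1} ->
  {for s, continuous f2} -> 0 < a s ->
  exists2 N, 0 < N & exists2 r, 0 < r & forall x, `|x - s| < r ->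
    `|(lam - H x (f1 x)) / a x - (lam - H x (f2 x)) / a x| <= N * `|f1 x - f2 x|.
Proof.
move=> c1 c2 as0.
have /continuous_atP/(_ _ ltr01)[r1 r10 hr1] := c1.
have /continuous_atP/(_ _ ltr01)[r2 r20 hr2] := c2.
have as2 : 0 < a s / 2 by lra.
have /continuous_atP/(_ _ as2)[r3 r30 hr3] := @a_cont s.
pose M := `|f1 s| + `|f2 s| + 1.
have [L L0 hL] := H_lipschitz_momentum gamma_gt2 HH M.
exists (2 * L / a s); first by rewrite divr_gt0// mulr_gt0.
have [k [k0 k1 k2]] := exists_smaller r10 r20.
have [r [r0 rk rr3]] := exists_smaller k0 r30.
exists r => // x xs.
have h1 := hr1 x (lt_trans xs (lt_trans rk k1)).
have h2 := hr2 x (lt_trans xs (lt_trans rk k2)).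
have := hr3 x (lt_trans xs rr3); rewrite ltr_norml => h3.
have n1 : `|f1 x| <= M.
  have -> : f1 x = f1 s + (f1 x - f1 s) by ring.
  apply: le_trans (ler_normD _ _) _.
  by have := normr_ge0 (f2 s); rewrite /M; lra.
have n2 : `|f2 x| <= M.
  have -> : f2 x = f2 s + (f2 x - f2 s) by ring.
  apply: le_trans (ler_normD _ _) _.
  by have := normr_ge0 (f1 s); rewrite /M; lra.
have ax : 0 < a x by lra.
have -> : (lam - H x (f1 x)) / a x - (lam - H x (f2 x)) / a x =
    - ((H x (f1 x) - H x (f2 x)) / a x) by field; rewrite gt_eqF.
rewrite normrN normrM normfV (gtr0_norm ax) ler_pdivrMr//.
apply: le_trans (hL x _ _ n1 n2) _; rewrite mulrAC ler_wpM2r//.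
have -> : 2 * L / a s * a x = L * (a x / (a s / 2)) by field; rewrite gt_eqF.
rewrite -[leLHS]mulr1 ler_pM2l// ler_pdivlMr//; lra.
Qed.

Lemma derive1_eq u1 u2 z t : dominating u1 -> dominating u2 -> z < t -> a z = 0 ->
  0 < a t -> derive1 u1 t = derive1 u2 t.
Proof.
move=> U1 U2 zt az at0.
have [l [hl al pos]] := last_zero zt az at0.
have lt : l < t by lra.
have [d1 d10 hd1] := derive1_le_near_zero U1 U2 al lt pos.
have [d2 d20 hd2] := derive1_le_near_zero U2 U1 al lt pos.
have [d [d0 dd1 dd2]] := exists_smaller d10 d20.
have lt0 : 0 < t - l by lra.
have [r [r0 rd rt]] := exists_smaller d0 lt0.
have [su1 _] := U1; have [su2 _] := U2.
apply/eqP; rewrite -subr_eq0; apply/eqP.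
have lrt : l + r <= t by lra.
apply: (@linear_ode_zero R (fun x => derive1 u1 x - derive1 u2 x)
  (fun x => (lam - H x (derive1 u1 x)) / a x - (lam - H x (derive1 u2 x)) / a x)
  (l + r) t lrt) => [x hx|x hx|].
- have ax : 0 < a x by apply: pos; lra.
  have [_ _ D1] := jet_sol_regular su1 ax; have [_ _ D2] := jet_sol_regular su2 ax.
  exact: is_deriveB.
- have ax : 0 < a x by apply: pos; lra.
  have [_ c1 _] := jet_sol_regular su1 ax; have [_ c2 _] := jet_sol_regular su2 ax.
  exact: ode_difference_bound.
- by apply/eqP; rewrite subr_eq0 eq_le hd1 ?hd2//; lra.
Qed.

(** If the difference rose, it would have a lower jet of slope above half its mean slope. Where
    [a > 0] that slope is zero; where [a = 0] it is bounded by the right difference quotients, which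
    are at most that half slope. *)
Theorem dominating_difference_le u1 u2 x y : dominating u1 -> dominating u2 ->
  (forall t, 0 < a t -> exists2 z, z < t & a z = 0) ->
  x < y -> u1 y - u2 y <= u1 x - u2 x.
Proof.
move=> U1 U2 left_zero xy; pose w t := u1 t - u2 t.
have [su1 _] := U1; have [su2 _] := U2.
have [cu1 _ _] := su1; have [cu2 _ _] := su2.
have cw t : {for t, continuous w} by apply: continuousB; [exact: cu1|exact: cu2].
suff : w y <= w x by [].
rewrite leNgt; apply/negP => wxy.
have yx : 0 < y - x by lra.
have m0 : 0 < (w y - w x) / (2 * (y - x)) by rewrite divr_gt0//; lra.
have [|z [p [C [hz mp j]]]] := @lower_jet_mean_value R w x y _ xy (fun t _ => cw t)
    (_ : (w y - w x) / (2 * (y - x)) * (y - x) < w y - w x).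
  rewrite (_ : _ * _ = (w y - w x) / 2); first by lra.
  by field; rewrite gt_eqF.
have [az|az] := leP (a z) 0; last first.
  have [z0 z0z az0] := left_zero z az.
  have [d1 _ _] := jet_sol_regular su1 az; have [d2 _ _] := jet_sol_regular su2 az.
  have := lower_jet_is_derive (is_deriveB d1 d2) j.
  by rewrite (derive1_eq U1 U2 z0z az0 az) subrr; lra.
have az' : a z = 0 by apply/eqP; rewrite eq_le az a_ge0.
have [d d0 hd] := right_derivative_difference U1 U2 az' m0.
have := lower_jet_le_slope d0 _ j => /(_ _ hd).
lra.
Qed.

End Uniqueness.

(** * Reflection and conclusion *)

Section Reflection.
Variable R : realType.
Implicit Types (a u v : R -> R) (H : R -> R -> R) (lam mu x z p C D : R).

Lemma lower_jet_reflect u z p C :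
  lower_jet (fun x => u (- x)) z p C -> lower_jet u (- z) (- p) C.
Proof.
move=> [d d0 hd]; exists d => // y yz; have := hd (- y).
rewrite opprK (_ : - y - z = - (y - - z)); last by ring.
by rewrite normrN => /(_ yz); lra.
Qed.

Lemma upper_jet_reflect u z p C :
  upper_jet (fun x => u (- x)) z p C -> upper_jet u (- z) (- p) C.
Proof.
move=> [d d0 hd]; exists d => // y yz; have := hd (- y).
rewrite opprK (_ : - y - z = - (y - - z)); last by ring.
by rewrite normrN => /(_ yz); lra.
Qed.

Lemma continuous_reflect u : continuous u -> continuous (fun x => u (- x)).
Proof.
move=> cu x; apply/continuous_atP => e e0.
have /continuous_atP/(_ e e0)[d d0 hd] := cu (- x).
by exists d => // y yx; apply: hd; rewrite -opprD normrN.
Qed.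

Lemma is_derive_reflect u z D :
  is_derive z 1 u D -> is_derive (- z) 1 (fun x => u (- x)) (- D).
Proof.
move=> /is_derive_smallP du; apply/is_derive_smallP => e e0.
have [d d0 hd] := du e e0; exists d => // y.
rewrite (_ : y - - z = - (- y - z)); last by ring.
by rewrite normrN mulrNN opprK => /hd.
Qed.

(** Reflection changes the sign of slopes but keeps second-order coefficients, so super- and
    subsolutions are not exchanged. *)
Lemma jet_sol_reflect a H lam u : jet_sol H a lam u ->
  jet_sol (fun x p => H (- x) (- p)) (fun x => a (- x)) lam (fun x => u (- x)).
Proof.
move=> [cu su sb]; split; first exact: continuous_reflect.
  by move=> z p C /lower_jet_reflect/su.
by move=> z p C /upper_jet_reflect/sb.
Qed.

Lemma densely_ge_reflect u v : densely_ge v u ->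
  densely_ge (fun x => u (- x)) (fun x => v (- x)).
Proof.
move=> vu x y xy; have [|s [Dv [Du [hs dv du DD]]]] := vu (- y) (- x); first by lra.
exists (- s), (- Du), (- Dv); split; [lra| | |lra]; exact: is_derive_reflect.
Qed.

(** The minimiser becomes [- phat (- x)] and the two monotone branches swap roles. *)
Lemma H_sqc_reflect (alpha0 alpha1 gamma eta : R) H :
  H_sqc alpha0 alpha1 gamma eta H ->
  H_sqc alpha0 alpha1 gamma eta (fun x p => H (- x) (- p)).
Proof.
move=> [h1 h2 h3 h4 [phat hp]]; split.
- by move=> x p; have := h1 (- x) (- p); rewrite normrN.
- by move=> x p q; have := h2 (- x) (- p) (- q); rewrite -opprD !normrN.
- by move=> x y p; have := h3 (- x) (- y) (- p); rewrite -opprD !normrN.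
- move=> x p q t pq t01; have := h4 (- x) (- p) (- q) t.
  by rewrite eqr_opp !mulrN -opprD; apply.
exists (fun x => - phat (- x)) => x; rewrite opprK.
have [m1 m2 m3 m4] := hp (- x); split.
- by move=> p; exact: m1.
- by move=> p pP; apply: m2; rewrite eqr_oppLR.
- move=> p1 p2 p12 p2x; have := m4 (- p2) (- p1).
  by rewrite -opprD normrN distrC; apply; lra.
- move=> p1 p2 p12 p2x; have := m3 (- p2) (- p1).
  by rewrite -opprD normrN distrC; apply; lra.
Qed.

End Reflection.

(** * Consequences of the assumptions on the diffusion and on the derivatives *)

Section Diffusion.
Variable R : realType.
Implicit Types (a u v : R -> R) (kappa t x y l : R).

(** An interval without a good point would lie in a null set although its length is positive. *)
Lemma ae_deriv_ge_dense u v : ae_deriv_ge u v -> densely_ge u v.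
Proof.
move=> [A [mA A0 hA]] x y xy; apply: contrapT => none.
have sub : [set` `]x, y[] `<=` A.
  move=> s; rewrite /= in_itv /= => hs; apply: hA => /= -[du dv DD]; apply: none.
  have D w : derivable w s 1 -> is_derive s 1 w (derive1 w s).
    by move=> dw; rewrite derive1E; exact: derivableP.
  exists s, (derive1 u s), (derive1 v s).
  by split; [exact: hs|exact: D|exact: D|exact: DD].
have : ((@lebesgue_measure R) [set` `]x, y[] <= lebesgue_measure A)%E.
  by apply: le_measure; rewrite ?inE//; exact: measurable_itv.
rewrite A0 lebesgue_measure_itv /= lte_fin xy -EFinB lee_fin; lra.
Qed.

Lemma diffusion_ge0 kappa a x : diffusion_ok kappa a -> 0 <= a x.
Proof. by move=> [h _ _ _]; have /andP[] := h x. Qed.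

Lemma diffusion_continuous kappa a : diffusion_ok kappa a -> continuous a.
Proof.
move=> da; have [_ lip _ _] := da.
have -> : a = (fun x => Num.sqrt (a x) * Num.sqrt (a x)).
  by apply/funext => x; rewrite -expr2 sqr_sqrtr// (diffusion_ge0 x da).
move=> x; have cs : {for x, continuous (fun x => Num.sqrt (a x))}.
  apply/continuous_atP => e e0.
  have k0 : 0 < `|kappa| + 1 by rewrite ltr_wpDl.
  exists (e / (`|kappa| + 1)) => [|y]; first by rewrite divr_gt0.
  rewrite ltr_pdivlMr// => yx; apply: le_lt_trans (lip y x) _.
  by have := ler_norm kappa; have := normr_ge0 (y - x); nra.
exact: (continuousM cs cs).
Qed.

Lemma diffusion_quadratic kappa a l t : diffusion_ok kappa a -> a l = 0 ->
  a t <= (kappa ^+ 2 + 1) * (t - l) ^+ 2.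
Proof.
move=> da al; have [_ lip _ _] := da.
have := lip t l; rewrite al sqrtr0 subr0 ger0_norm ?sqrtr_ge0// => h.
rewrite -[leLHS]sqr_sqrtr ?(diffusion_ge0 t da)//.
have : Num.sqrt (a t) ^+ 2 <= (kappa * `|t - l|) ^+ 2.
  by rewrite ler_pXn2r ?nnegrE ?sqrtr_ge0// (le_trans _ h) ?sqrtr_ge0.
rewrite exprMn real_normK ?num_real// => h2.
by rewrite mulrDl mul1r (le_trans h2)// lerDl sqr_ge0.
Qed.

(** Otherwise the connected half-line ending at [t] lies in the component of [t], which is
    bounded. *)
Lemma diffusion_left_zero kappa a t : diffusion_ok kappa a -> 0 < a t ->
  exists2 z, z < t & a z = 0.
Proof.
move=> da at0; have [_ _ _ comp] := da; have [_ [M hM]] := comp t at0.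
apply: contrapT => /forall2NP none.
have pos : `]-oo, t] `<=` [set y | 0 < a y].
  move=> y; rewrite /= in_itv /= le_eqVlt => /predU1P[->//|yt].
  by have [|/eqP ay] := none y; [rewrite yt|rewrite lt_def ay (diffusion_ge0 y da)].
have : `]-oo, t] `<=` connected_component [set y | 0 < a y] t.
  apply: connected_component_max => //; first by rewrite /= in_itv /=.
  exact/connected_intervalP/interval_is_interval.
move=> /(_ (Num.min t (- (`|M| + 1)))).
rewrite /= in_itv /= ge_min lexx => /(_ isT)/hM.
have := ler_norm M; have := normr_ge0 M.
have [h|h] := leP t (- (`|M| + 1)).
  by rewrite ler_norml; lra.
by rewrite ler_norml; lra.
Qed.

Lemma diffusion_right_zero kappa a t : diffusion_ok kappa a -> 0 < a t ->
  exists2 z, t < z & a z = 0.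
Proof.
move=> da at0; have [_ _ _ comp] := da; have [_ [M hM]] := comp t at0.
apply: contrapT => /forall2NP none.
have pos : `[t, +oo[ `<=` [set y | 0 < a y].
  move=> y; rewrite /= in_itv /= andbT le_eqVlt => /predU1P[<-//|yt].
  by have [|/eqP ay] := none y; [rewrite yt|rewrite lt_def ay (diffusion_ge0 y da)].
have : `[t, +oo[ `<=` connected_component [set y | 0 < a y] t.
  apply: connected_component_max => //; first by rewrite /= in_itv /= lexx.
  exact/connected_intervalP/interval_is_interval.
move=> /(_ (Num.max t (`|M| + 1))).
rewrite /= in_itv /= le_max lexx => /(_ isT)/hM.
have := ler_norm M; have := normr_ge0 M.
by have [h|h] := leP t (`|M| + 1); rewrite ler_norml; lra.
Qed.

End Diffusion.

Lemma dominating_difference_constant (R : realType)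
  (alpha0 alpha1 gamma eta K lam mu : R) (H : R -> R -> R) (a u1 u2 : R -> R) :
  0 < alpha0 -> 2 < gamma -> 0 < eta -> H_sqc alpha0 alpha1 gamma eta H ->
  continuous a -> (forall x, 0 <= a x) -> 0 < K ->
  (forall l t, a l = 0 -> a t <= K * (t - l) ^+ 2) -> mu < lam ->
  (forall t, 0 < a t -> exists2 z, z < t & a z = 0) ->
  dominating H a lam mu u1 -> dominating H a lam mu u2 ->
  exists c, forall x, u1 x - u2 x = c.
Proof.
move=> al ga et HH ca a0 K0 aq ml lz U1 U2; exists (u1 0 - u2 0) => x.
have le u v x0 y0 : dominating H a lam mu u -> dominating H a lam mu v ->
    x0 < y0 -> u y0 - v y0 <= u x0 - v x0.
  by move=> U V; exact: (dominating_difference_le al ga et HH ca a0 K0 aq ml U V lz).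
have [x0|x0|->//] := ltgtP x 0.
  by have := le _ _ _ _ U1 U2 x0; have := le _ _ _ _ U2 U1 x0; lra.
by have := le _ _ _ _ U1 U2 x0; have := le _ _ _ _ U2 U1 x0; lra.
Qed.

Theorem mainTheorem12 (R : realType) (kappa : R) (a : R -> R)
  (alpha0 alpha1 gamma eta : R) (H : R -> R -> R)
  (lam lam0 : R) (u1 u2 v1 v2 : R -> R) :
  diffusion_ok kappa a ->
  0 < alpha0 -> 2 < gamma -> 0 < eta ->
  H_sqc alpha0 alpha1 gamma eta H ->
  lambda0 a H = lam0%:E ->
  lam0 < lam ->
  visc_sol a H lam u1 -> visc_sol a H lam u2 ->
  visc_sol a H lam0 v1 -> visc_sol a H lam0 v2 ->
  ((ae_deriv_ge u1 v1 /\ ae_deriv_ge u2 v2) ->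
     exists c : R, forall x, u1 x - u2 x = c) /\
  ((ae_deriv_ge v1 u1 /\ ae_deriv_ge v2 u2) ->
     exists c : R, forall x, u1 x - u2 x = c).
Proof.
move=> da al ga et HH _ ml su1 su2 sv1 sv2.
have sol nu w : visc_sol a H nu w -> jet_sol H a nu w.
  move=> [sup sub]; split; [by case: sup|exact: visc_super_jet|exact: visc_sub_jet].
have K0 : 0 < kappa ^+ 2 + 1 by rewrite ltr_wpDl// sqr_ge0.
have ca := diffusion_continuous da.
split=> -[/ae_deriv_ge_dense uv1 /ae_deriv_ge_dense uv2].
  apply: (dominating_difference_constant al ga et HH ca _ K0 _ ml).
  - by move=> x; exact: (diffusion_ge0 _ da).
  - by move=> l t; exact: (diffusion_quadratic _ da).
  - by move=> t; exact: (diffusion_left_zero da).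
  - by split; [exact: sol|exists v1; split=> //; exact: sol].
  - by split; [exact: sol|exists v2; split=> //; exact: sol].
(* Reflection reverses the order of derivatives, so the reflected [u1] and [u2] dominate the
   reflected [v1] and [v2]; the right zeros of [a] now supply the left zeros. *)
have [c hc] : exists c, forall x, u1 (- x) - u2 (- x) = c.
  apply: (@dominating_difference_constant _ _ _ _ _ _ _ _ _ _
    (fun x => u1 (- x)) (fun x => u2 (- x)) al ga et (H_sqc_reflect HH)
    (continuous_reflect ca) _ K0 _ ml).
  - by move=> x; exact: (diffusion_ge0 _ da).
  - move=> l t al0; have := diffusion_quadratic (- t) da al0.
    by rewrite -opprD sqrrN.
  - move=> t at0; have [z tz az] := diffusion_right_zero da at0.
    by exists (- z); [lra|rewrite opprK].
  - split; first exact/jet_sol_reflect/sol.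
    exists (fun x => v1 (- x)); split; first exact/jet_sol_reflect/sol.
    exact: densely_ge_reflect.
  - split; first exact/jet_sol_reflect/sol.
    exists (fun x => v2 (- x)); split; first exact/jet_sol_reflect/sol.
    exact: densely_ge_reflect.
by exists c => x; have := hc (- x); rewrite opprK.
Qed.
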